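(* Let $a<b$ be real numbers. Let $g:\mathbb{R}\to\mathbb{R}$ be almost everywhere continuous (i.e. its set of discontinuity points has Lebesgue measure zero), and suppose there exist $\alpha>0$, $s\in(1,2)$, and $0<c<d$ such that, writing $J_g(t)=\int_0^t g(\tau)\,d\tau$, (i) $g(t)\le\alpha(1+|t|^{s-1})$ for all $t\in\mathbb{R}$; (ii) $\operatorname{ess\,inf}_{t\in\mathbb{R}}g(t)>0$; (iii) $\displaystyle\frac{J_g(c)}{c^2}<\frac{J_g(d)}{4d^2}$. Set $$\Lambda=\left(\frac{2d^2}{(b-a)^2J_g(d)},\ \frac{c^2}{2(b-a)^2J_g(c)}\right).$$ Then, for all $\lambda\in\Lambda$, the problem $$\begin{cases}-u''=\lambda g(u)&\text{in }(a,b)\\ u(a)=u'(b)=0\end{cases}$$ has at least three nonzero (weak) solutions.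
   Context: Let $X=\{u\in H^1(a,b): u(a)=0\}$. A function $u\in X$ is a (weak) solution of the problem if $\int_a^b u'v'\,dx=\lambda\int_a^b g(u)v\,dx$ for all $v\in X$. *)

(* Defs.v *)
From HB Require Import structures.
From mathcomp Require Import all_boot all_order all_algebra.
From mathcomp Require Import all_classical all_reals all_analysis.

Set Implicit Arguments.
Unset Strict Implicit.
Unset Printing Implicit Defensive.
Import Order.TTheory GRing.Theory Num.Theory.
Import numFieldNormedType.Exports.

Local Open Scope classical_set_scope.
Local Open Scope ring_scope.

(* The completed measure is used because an almost everywhere continuous
   function, and its composition with a solution, need only be Lebesgue
   measurable, not Borel measurable. *)
Notation leb R := (@completed_lebesgue_measure R).

Section defs.
Context {R : realType}.
Implicit Types (a b lambda t : R) (g u v w z phi : R -> R).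

Definition ae_continuous g : Prop :=
  (leb R).-negligible [set t : R | ~ {for t, continuous g}].

(* Oriented integral: for t < 0 it is minus the integral over [t, 0]. *)
Definition J g t : R :=
  if 0 <= t then \int[leb R]_(x in `[0, t]) g x
  else - \int[leb R]_(x in `[t, 0]) g x.

Definition L2 a b u : Prop :=
  measurable_fun (`]a, b[ : set (caratheodory_type (@wlength R idfun)^*%mu)) u /\
  (leb R).-integrable `]a, b[ (fun x => (u x ^+ 2)%:E).

(* C^1_c(a, b), extended by 0. The closure of the support is automatically
   bounded, so its inclusion in the open interval makes it compact there. *)
Definition test_function a b phi : Prop :=
  [/\ (forall x, derivable phi x 1), continuous (derive1 phi) &
      closure [set x | phi x != 0] `<=` `]a, b[].

Definition weak_derivative a b u w : Prop :=
  forall phi, test_function a b phi ->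
    \int[leb R]_(x in `]a, b[) (u x * derive1 phi x) =
    - \int[leb R]_(x in `]a, b[) (w x * phi x).

(* w is a representative of u' for u in H^1(a, b). *)
Definition H1_deriv a b u w : Prop :=
  [/\ L2 a b u, L2 a b w & weak_derivative a b u w].

Definition Sobolev_H1 a b u : Prop := exists w, H1_deriv a b u w.

(* Elements of H^1(a, b) are given by their representative that is continuous
   on [a, b], which is the one for which the value at a is meant. Values
   outside [a, b] are irrelevant. *)
Definition space_X a b u : Prop :=
  [/\ Sobolev_H1 a b u, {within `[a, b], continuous u} & u a = 0].

(* Integrability of g(u) v is required because Rintegral takes a junk value
   otherwise; u' v' is integrable since both factors are in L^2. *)
Definition weak_solution a b g lambda u : Prop :=
  space_X a b u /\
  exists2 w, H1_deriv a b u w &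
    forall v z, space_X a b v -> H1_deriv a b v z ->
      (leb R).-integrable `]a, b[ (fun x => (g (u x) * v x)%:E) /\
      \int[leb R]_(x in `]a, b[) (w x * z x) =
      lambda * \int[leb R]_(x in `]a, b[) (g (u x) * v x).

(* Inequality in H^1(a, b), for continuous representatives. *)
Definition differ_on a b u v : Prop :=
  exists2 x, x \in `[a, b] & u x != v x.

End defs.

(* Main.v *)
Require Import Defs.
From HB Require Import structures.
From mathcomp Require Import all_boot all_order all_algebra.
From mathcomp Require Import all_classical all_reals all_analysis.
From mathcomp Require Import ess_sup_inf measurable_realfun.
From mathcomp Require Import ring lra.

Set Implicit Arguments.
Unset Strict Implicit.
Unset Printing Implicit Defensive.
Import Order.TTheory GRing.Theory Num.Theory.
Import numFieldNormedType.Exports.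

(** A solution is determined by its amplitude, and the admissible amplitudes are
    the solutions of one scalar equation, which turns out to have three roots.

    Put [L = b - a] and let [P t] be twice lambda times the integral of [g] over
    [0, t]. Since [g] is positive almost everywhere, a solution increases from
    [u a = 0] to its maximum [M = u b], and conservation of the energy
    [u' ^ 2 + P u] gives [u' = sqrt (P M - P u)]. Hence the time spent between
    heights [0] and [M], that is the integral of [1 / sqrt (P M - P r)] over
    [0, M], must equal [L]. Conversely, any [M > 0] for which this time map [T]
    takes the value [L] yields a solution, the inverse function of the time
    needed to reach a height ([solution_of_amplitude]).

    The substitution [r = M (1 - q ^ 2)] turns the time map into an integral over
    [0, 1] of a bounded function ([slowness]); all estimates on [T] and the
    construction of the inverse function are carried out in the variable [q].
    - [T] is continuous, and [T M] is at most a constant times [sqrt M], so it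
      is smaller than [L] for small [M];
    - [T c >= c / sqrt (P c) > L], by the upper bound on lambda
      ([time_map1_ge]);
    - [T] takes a value below [L] somewhere in [c, d] ([time_map_dip]), by the
      lower bound on lambda;
    - [T M] tends to infinity with [M], because [g] grows sublinearly.
    The intermediate value theorem gives three amplitudes
    ([three_amplitudes]).

    The third point is where the variational nature of the problem enters. For
    [h >= P M], the concave function of [h] given by the integral of
    [sqrt (h - P r)] over [0, M], minus [h L / 2], is a lower bound for the energy
    functional on the functions that reach the height [M]; its derivative in [h] at
    [h = P M] is [(T M - L) / 2]. It is positive for a suitable [h] at [M = c], and
    negative at [M = d] for every admissible [h], as comparison with the function
    that is linear up to the height [d] at the midpoint of [a, b] and constant
    afterwards shows. If [T >= L] on [c, d], then the value at [h = P M] is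
    nondecreasing in [M], which is contradictory.

    The remaining part is real analysis. The function [w = u'] is Lipschitz, and
    its derivative is [- lambda g u] outside the preimage by [u] of a null set, which
    is null ([expanding_preimage_null]); so [w x] is the integral of
    [lambda g u] over [x, b] ([lipschitz_FTC2]). An element [v] of [X] is the
    integral from [a] of its weak derivative ([H1_primitive]), and the weak
    equation is then Fubini's theorem on a triangle ([weak_solutionP]). Almost
    everywhere continuity of [g] serves to replace [g] by a Borel function which
    is bounded below everywhere ([ae_continuous_borel]). *)

Local Open Scope classical_set_scope.
Local Open Scope ring_scope.

Local Notation mu := lebesgue_measure.
Local Notation cara R := (caratheodory_type (@wlength R idfun)^*%mu).

(** * Lebesgue measure on Borel sets and its completion *)

Section transfer.
Context {R : realType}.

Lemma measurable_cara (A : set R) :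
  measurable A -> measurable (A : set (cara R)).
Proof. exact: sub_caratheodory. Qed.

Lemma measurable_id_cara : measurable_fun [set: cara R] (fun x : cara R => (x : R)).
Proof. by move=> _ A mA; rewrite setTI; exact: measurable_cara. Qed.

Lemma measurable_fun_cara d (Y : measurableType d) (D : set R) (f : R -> Y) :
  measurable D -> measurable_fun D f ->
  measurable_fun (D : set (cara R)) f.
Proof. by move=> mD mf _ A mA; exact: measurable_cara (mf mD A mA). Qed.

(** Lebesgue measure on Borel sets is the pushforward of its completion by the
    identity, which is measurable from the larger to the smaller sigma-algebra. *)
Lemma ge0_integral_leb (D : set R) (f : R -> \bar R) :
  measurable D -> measurable_fun D f -> (forall x, D x -> 0 <= f x)%E ->
  (\int[leb R]_(x in D) f x = \int[mu]_(x in D) f x)%E.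
Proof.
move=> mD mf f0.
have <- := @ge0_integral_pushforward _ _ _ (measurableTypeR R) _ _
    measurable_id_cara (leb R) D f mD mf => //.
by move=> x; rewrite inE => /f0.
Qed.

Lemma integral_leb (D : set R) (f : R -> \bar R) :
  measurable D -> measurable_fun D f ->
  (\int[leb R]_(x in D) f x = \int[mu]_(x in D) f x)%E.
Proof.
move=> mD mf; rewrite integralE [RHS]integralE.
by rewrite !ge0_integral_leb //; [exact: measurable_funeneg | exact: measurable_funepos].
Qed.

Lemma integrable_leb (D : set R) (f : R -> \bar R) :
  measurable D -> mu.-integrable D f -> (leb R).-integrable D f.
Proof.
move=> mD /integrableP[mf fi]; apply/integrableP; split.
  exact: measurable_fun_cara.
by rewrite ge0_integral_leb //; exact: measurableT_comp.
Qed.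

Lemma Rintegral_leb (D : set R) (f : R -> R) :
  measurable D -> measurable_fun D f ->
  \int[leb R]_(x in D) f x = \int[mu]_(x in D) f x.
Proof. by move=> mD mf; rewrite /Rintegral integral_leb//; exact/measurable_EFinP. Qed.

(** A set which is measurable for the completion differs from a Borel set by a
    subset of a Borel null set, so both measures have the same null sets. *)
Lemma leb_negligible (N : set R) : (leb R).-negligible N <-> mu.-negligible N.
Proof.
split=> [[/= B [mB B0 NB]]|[/= B [mB B0 NB]]]; last first.
  by exists B; split => //; exact: measurable_cara.
have : (completed_algebra_gen (@lebesgue_measure R)) B.
  by rewrite -g_sigma_completed_algebra_genE completed_caratheodory_measurable.
move=> [/= A mA [N' N'0 AN']].
apply: (@negligibleS _ _ _ mu B N NB); rewrite -AN'; apply: negligibleU => //.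
apply/negligibleP => //; apply/eqP; rewrite -measure_le0 -B0.
by apply: (@le_outer_measure _ _ (@lebesgue_measure R)) => x Ax; rewrite -AN'; left.
Qed.

Lemma ae_eq_measurable_leb (D : set R) (f g : R -> R) :
  {ae leb R, forall x, D x -> f x = g x} ->
  measurable_fun (D : set (cara R)) (EFin \o f) ->
  measurable_fun (D : set (cara R)) (EFin \o g).
Proof.
move=> fg; apply: (ae_measurable_fun completed_lebesgue_measure_is_complete).
by apply: negligibleS fg => x /= H E; apply: H => Dx /=; rewrite (E Dx).
Qed.

Lemma ae_eq_Rintegral_leb (D : set R) (f g : R -> R) :
  measurable (D : set (cara R)) -> {ae leb R, forall x, D x -> f x = g x} ->
  measurable_fun (D : set (cara R)) (EFin \o f) ->
  \int[leb R]_(x in D) f x = \int[leb R]_(x in D) g x.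
Proof.
move=> mD fg mf; have mg := ae_eq_measurable_leb fg mf.
apply: (congr1 fine); apply: ae_eq_integral; [exact: mD|exact: mf|exact: mg|].
by apply: negligibleS fg => x /= H E; apply: H => Dx /=; rewrite (E Dx).
Qed.

Lemma ae_eq_integrable_leb (D : set R) (f g : R -> R) :
  measurable (D : set (cara R)) -> {ae leb R, forall x, D x -> f x = g x} ->
  (leb R).-integrable D (EFin \o f) -> (leb R).-integrable D (EFin \o g).
Proof.
move=> mD fg /integrableP[mf foo]; have mg := ae_eq_measurable_leb fg mf.
have maf : measurable_fun (D : set (cara R)) (abse \o (EFin \o f)).
  exact: measurableT_comp.
have mag : measurable_fun (D : set (cara R)) (abse \o (EFin \o g)).
  exact: measurableT_comp.
apply/integrableP; split; first exact: mg.
rewrite (_ : (\int[_]_(x in _) _)%E = (\int[leb R]_(x in D) `|(f x)%:E|)%E)//.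
symmetry; apply: ae_eq_integral; [exact: mD|exact: maf|exact: mag|].
by apply: negligibleS fg => x /= H E; apply: H => Dx /=; rewrite (E Dx).
Qed.

(** A Borel null set [E] contains the discontinuities of [g] and the points where
    the lower bound fails; on the complement of [E], [g] is continuous for the
    subspace topology, hence Borel, and its values on [E] are changed to [m0]. *)
Lemma ae_continuous_borel (g : R -> R) (m0 : R) : ae_continuous g ->
  (\forall t \ae leb R, m0 <= g t) ->
  exists (E : set R) (h : R -> R), [/\ measurable E /\ mu E = 0%E, measurable_fun setT h,
    forall t, ~ E t -> h t = g t, forall t, m0 <= h t & forall t, h t = g t \/ h t = m0].
Proof.
move=> /leb_negligible N1 /leb_negligible N2.
have [E [mE E0 NE]] := negligibleU N1 N2.
exists E, (fun t => if t \in E then m0 else g t); split => //.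
- have mCE : measurable (~` E) by exact: measurableC.
  rewrite -(setUv E); apply/measurable_funU => //; split.
    apply: (eq_measurable_fun (cst m0)); last exact: measurable_cst.
    by move=> t tE; rewrite tE.
  apply: (eq_measurable_fun g).
    by move=> t; rewrite inE => tE; rewrite memNset.
  apply: subspace_continuous_measurable_fun => //.
  apply: continuous_in_subspaceT => t; rewrite inE => tE.
  by apply: contrapT => gt; apply: tE; apply: NE; left.
- by move=> t tE; rewrite memNset.
- move=> t; case: ifPn => // /negP tE.
  by apply: contrapT => gt; apply: tE; rewrite inE; apply: NE; right.
- by move=> t; case: ifP; [right|left].
Qed.

End transfer.

(** * Integrals over segments *)

Section basics.
Context {R : realType}.
Implicit Types (f w h : R -> R) (x y z : R).

Lemma bounded_integrable f x y C : measurable_fun `[x, y] f ->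
  (forall t, t \in `[x, y] -> `|f t| <= C) ->
  mu.-integrable `[x, y] (EFin \o f).
Proof.
move=> mf fC; apply: measurable_bounded_integrable => //.
  rewrite /= lebesgue_measure_itv/=; case: ifP => // _.
  by rewrite -EFinB ltry.
exists C; split; first exact: num_real.
by move=> M CM t /= txy; rewrite (le_trans (fC t _)) ?ltW.
Qed.

Lemma continuous_integrable f x y : continuous f -> mu.-integrable `[x, y] (EFin \o f).
Proof.
move=> cf; apply: continuous_compact_integrable; first exact: segment_compact.
exact: continuous_subspaceT.
Qed.

Lemma Rintegral_chasles f x y z : x <= y -> y <= z ->
  mu.-integrable `[x, z] (EFin \o f) ->
  \int[mu]_(t in `[x, z]) f t = \int[mu]_(t in `[x, y]) f t + \int[mu]_(t in `[y, z]) f t.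
Proof.
move=> xy yz fi; apply/eqP; rewrite addrC -subr_eq; apply/eqP.
rewrite Rintegral_itvB ?bnd_simp//.
rewrite Rintegral_itv_obnd_cbnd//; apply: integrableS fi => //.
by apply: subset_itv; rewrite bnd_simp.
Qed.

Lemma Rintegral_itv_cst x y (k : R) : x <= y ->
  \int[mu]_(t in `[x, y]) k = k * (y - x).
Proof.
move=> xy; rewrite Rintegral_cst//; congr (_ * _).
rewrite /= lebesgue_measure_itv/= lte_fin.
by move: xy; rewrite le_eqVlt => /predU1P[->|->]; rewrite ?ltxx ?subrr.
Qed.

Lemma Rintegral_le_bound f x y C : x <= y -> mu.-integrable `[x, y] (EFin \o f) ->
  (forall t, t \in `[x, y] -> f t <= C) ->
  \int[mu]_(t in `[x, y]) f t <= C * (y - x).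
Proof.
move=> xy fi fC; rewrite -Rintegral_itv_cst//; apply: le_Rintegral => //.
by apply: continuous_integrable; exact: cst_continuous.
Qed.

Lemma Rintegral_ge_bound f x y C : x <= y -> mu.-integrable `[x, y] (EFin \o f) ->
  (forall t, t \in `[x, y] -> C <= f t) ->
  C * (y - x) <= \int[mu]_(t in `[x, y]) f t.
Proof.
move=> xy fi fC; rewrite -Rintegral_itv_cst//; apply: le_Rintegral => //.
by apply: continuous_integrable; exact: cst_continuous.
Qed.

Lemma Rintegral_itv_oo f x y : mu.-integrable `[x, y] (EFin \o f) ->
  \int[mu]_(t in `]x, y[) f t = \int[mu]_(t in `[x, y]) f t.
Proof.
move=> fi; rewrite Rintegral_itv_bndo_bndc; last first.
  by apply: integrableS fi => //; exact: subset_itv_oo_cc.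
rewrite Rintegral_itv_obnd_cbnd//.
by apply: integrableS fi => //; exact: subset_itv_oc_cc.
Qed.

Lemma continuous_integrable_leb a b f : continuous f -> (leb R).-integrable `]a, b[ (EFin \o f).
Proof.
move=> cf; apply: integrable_leb => //.
apply: (@integrableS _ _ _ mu `[a, b]%classic) => //; first exact: subset_itv_oo_cc.
exact: continuous_integrable.
Qed.

Lemma Rintegral_leb_oo a b f : mu.-integrable `[a, b] (EFin \o f) ->
  \int[leb R]_(x in `]a, b[) f x = \int[mu]_(x in `[a, b]) f x.
Proof.
move=> fi; rewrite Rintegral_leb ?Rintegral_itv_oo//.
apply/measurable_EFinP; apply: measurable_funS (measurable_int _ fi) => //.
exact: subset_itv_oo_cc.
Qed.

Lemma lipschitz_continuous f (K : R) : (forall x y, `|f x - f y| <= K * `|x - y|) ->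
  continuous f.
Proof.
move=> fK x; apply/cvgrPdist_le => e e0; near=> y.
rewrite (le_trans (fK _ _))//.
have K0 : 0 < `|K| + 1 by rewrite ltr_wpDl.
rewrite (@le_trans _ _ ((`|K| + 1) * `|x - y|))//.
  by rewrite ler_wpM2r// (le_trans (ler_norm _))// lerDl.
rewrite mulrC -ler_pdivlMr//; near: y.
by apply: cvgr_dist_le; [exact: cvg_id|exact: divr_gt0].
Unshelve. all: by end_near. Qed.

(** The part of [D] that [f] sends into an interval of length [l] has diameter at most
    [l / k], so it lies in an interval of length [2 l / k]; covers of [E] by
    intervals thus pull back to covers of comparable total length. *)
Lemma expanding_preimage_null (D E : set R) f k : 0 < k ->
  (forall x y, D x -> D y -> k * `|x - y| <= `|f x - f y|) ->
  (mu E = 0 -> mu (D `&` f @^-1` E) = 0)%E.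
Proof.
move=> k0 fk E0.
have H s : (0 < s)%R -> (mu (D `&` f @^-1` E) <= (2 / k * s)%:E)%E.
  move=> s0; have : mu E \is a fin_num by rewrite E0.
  move/lb_ereal_inf_adherent => /(_ _ s0)[_/= [A [mA EA] <-]].
  rewrite [X in (X + _)%E](_ : _ = 0%E); last exact: E0.
  rewrite add0e => As.
  apply: (@le_trans _ _ (mu (\bigcup_n (D `&` f @^-1` (A n))))).
    apply: le_outer_measure => x [Dx fx]; have [n _ An] := EA _ fx.
    by exists n.
  apply: (le_trans (outer_measure_sigma_subadditive _ _)).
  apply: (@le_trans _ _ (\sum_(0 <= n <oo) ((2 / k)%:E * wlength idfun (A n)))%E).
    apply: lee_nneseries => [n _ _|n _]; first exact: outer_measure_ge0.
    have [[p q] _ Apq] := mA n.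
    have [->|/set0P[x0 [Dx0 Ax0]]] := eqVneq (D `&` f @^-1` (A n)) set0.
      by rewrite outer_measure0 mule_ge0// lee_fin divr_ge0// ltW.
    move: Ax0; rewrite -Apq /= in_itv/= => /andP[px0 x0q].
    have pq : (p < q)%R by exact: lt_le_trans x0q.
    apply: (@le_trans _ _ (mu (`[x0 - (q - p) / k, x0 + (q - p) / k]%classic : set R))).
      apply: le_outer_measure => x [Dx]; rewrite /= !in_itv/= => /andP[px xq].
      rewrite -ler_distlC ler_pdivlMr// mulrC (le_trans (fk _ _ Dx0 Dx))//.
      by rewrite ler_distlC; apply/andP; split; lra.
    have qp : (0 < (q - p) / k)%R by rewrite divr_gt0// subr_gt0.
    rewrite lebesgue_measure_itv/= wlength_itv/= !lte_fin pq.
    rewrite ifT; last lra.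
    by rewrite -!EFinB -EFinM lee_fin; lra.
  rewrite nneseriesZl//.
  by rewrite [leRHS]EFinM lee_wpmul2l ?lee_fin ?divr_ge0 ?(ltW k0) ?(ltW As).
apply/eqP; rewrite -measure_le0; apply/lee_addgt0Pr => e e0; rewrite add0e.
have := H (e * (k / 2)); rewrite (_ : (2 / k * (e * (k / 2)) = e)%R); last first.
  by field; rewrite gt_eqF.
by apply; rewrite mulr_gt0// divr_gt0.
Qed.

End basics.

(** * The fundamental theorem of calculus for Lipschitz functions *)

Section lipschitz_ftc.
Context {R : realType}.
Implicit Types (f w h : R -> R) (x y z : R).

Lemma Rintegral_shift f x y s : continuous f -> x <= y ->
  \int[mu]_(t in `[x, y]) f (t + s) = \int[mu]_(t in `[x + s, y + s]) f t.
Proof.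
move=> cf xy; rewrite /Rintegral.
have dE : derive1 (fun t : R => t + s) = cst 1.
  apply/funext => t; rewrite derive1E; apply: (derive_val (f := shift s)).
  exact: is_derive_shift.
rewrite (@integration_by_substitution_increasing _ (fun t => t + s) f x y)//.
- rewrite dE.
  by under [in RHS]eq_integral do rewrite /= mulr1.
- by move=> u v _ _ uv; rewrite ltrD2r.
- rewrite dE.
  by move=> ? _; exact: cvg_cst.
- rewrite dE.
  exact: is_cvg_cst.
- rewrite dE.
  exact: is_cvg_cst.
- split.
  + by move=> t _; exact: derivableD.
  + by apply: cvg_at_right_filter; apply: cvgD => //; exact: cvg_cst.
  + by apply: cvg_at_left_filter; apply: cvgD => //; exact: cvg_cst.
- exact: continuous_subspaceT.
Qed.

(** Gives the limits of the two boundary terms in the proof of [lipschitz_FTC2]. *)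
Lemma cvg_mean_right f (u : R^nat) x (K : R) :
  (forall x y, `|f x - f y| <= K * `|x - y|) ->
  (forall n, 0 < u n) -> u @ \oo --> 0 ->
  (u n)^-1 * (\int[mu]_(t in `[x, x + u n]) f t) @[n --> \oo] --> f x.
Proof.
move=> fK u0 u_0; have cf := lipschitz_continuous fK.
apply/cvgrPdist_le => e e0; near=> n.
have xn : x <= x + u n by rewrite lerDl ltW.
have fxn t : t \in `[x, x + u n] -> `|f x - f t| <= `|K| * u n.
  rewrite in_itv/= => /andP[xt tu]; rewrite (le_trans (fK _ _))//.
  rewrite (le_trans (ler_norm _))// normrM normr_id ler_wpM2l//.
  by rewrite ler_norml; apply/andP; split; lra.
have fi := continuous_integrable x (x + u n) cf.
have Kn : `|K| * u n <= e.
  have K0 : 0 < `|K| + 1 by rewrite ltr_wpDl.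
  rewrite (@le_trans _ _ ((`|K| + 1) * u n))//.
    by rewrite ler_wpM2r ?lerDl// ltW.
  rewrite mulrC -ler_pdivlMr// -[leLHS]gtr0_norm// -[`|_|]normrN -sub0r.
  near: n; apply: cvgr_dist_le; first exact: u_0.
  exact: divr_gt0.
rewrite (le_trans _ Kn)// -(ler_pM2l (u0 n)) -[X in X * `|_|]gtr0_norm// -normrM.
have H1 := @Rintegral_le_bound _ f x (x + u n) (f x + `|K| * u n) xn fi.
have H2 := @Rintegral_ge_bound _ f x (x + u n) (f x - `|K| * u n) xn fi.
have {}H1 : \int[mu]_(t in `[x, x + u n]) f t <= (f x + `|K| * u n) * u n.
  rewrite [X in _ <= _ * X](_ : _ = x + u n - x); last by rewrite addrAC subrr add0r.
  by apply: H1 => t /fxn; rewrite ler_distlC => /andP[]; lra.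
have {}H2 : (f x - `|K| * u n) * u n <= \int[mu]_(t in `[x, x + u n]) f t.
  rewrite [X in _ * X <= _](_ : _ = x + u n - x); last by rewrite addrAC subrr add0r.
  by apply: H2 => t /fxn; rewrite ler_distlC => /andP[]; lra.
rewrite mulrBr mulrA divff ?gt_eqF// mul1r ler_norml.
by apply/andP; split; lra.
Unshelve. all: by end_near. Qed.

(** The difference quotients [(w (t + e) - w t) / e] are bounded by the Lipschitz
    constant and converge almost everywhere to [h], so their integrals converge
    to the integral of [h]. After a translation the integral of such a quotient
    is the mean of [w] over [b, b + e] minus its mean over [a, a + e]. *)
Lemma lipschitz_FTC2 w h (K : R) (N : set R) (a b : R) : a <= b ->
  (forall x y, `|w x - w y| <= K * `|x - y|) ->
  measurable_fun `[a, b] h -> mu.-negligible N ->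
  (forall x, x \in `]a, b[ -> ~ N x -> is_derive x 1 w (h x)) ->
  \int[mu]_(t in `[a, b]) h t = w b - w a.
Proof.
move=> ab wK mh N0 wh; have cw := lipschitz_continuous wK.
pose u n : R := n.+1%:R^-1.
have u0 n : 0 < u n by rewrite invr_gt0.
have u_0 : u @ \oo --> 0 by exact: cvg_harmonic.
pose f n t := (u n)^-1 * (w (t + u n) - w t).
have cwu n : continuous (fun t => w (t + u n)).
  move=> t; apply: (@continuous_comp _ _ _ (fun t => t + u n) w); last exact: cw.
  by apply: cvgD; [exact: cvg_id|exact: cvg_cst].
have cf n : continuous (f n).
  move=> t; apply: cvgM; first exact: cvg_cst.
  by apply: cvgB; [exact: cwu|exact: cw].
have fE n : \int[mu]_(t in `[a, b]) f n t =
    (u n)^-1 * (\int[mu]_(t in `[b, b + u n]) w t) -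
    (u n)^-1 * (\int[mu]_(t in `[a, a + u n]) w t).
  have un := ltW (u0 n).
  rewrite RintegralZl//; last first.
    apply: continuous_integrable => t.
    by apply: cvgB; [exact: cwu|exact: cw].
  rewrite RintegralB//; [|exact: continuous_integrable..].
  rewrite Rintegral_shift// -mulrBr; congr (_ * _).
  have A1 : a <= a + u n by rewrite lerDl.
  have A2 : b <= b + u n by rewrite lerDl.
  have A3 : a + u n <= b + u n by rewrite lerD2r.
  have := @Rintegral_chasles _ w _ _ _ ab A2 (continuous_integrable _ _ cw).
  rewrite (@Rintegral_chasles _ w _ _ _ A1 A3 (continuous_integrable _ _ cw)).
  lra.
have lim1 : \int[mu]_(t in `[a, b]) f n t @[n --> \oo] --> w b - w a.
  under eq_fun do rewrite fE.
  by apply: cvgB; exact: cvg_mean_right wK u0 u_0.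
have mf_ n : measurable_fun `[a, b] (EFin \o f n).
  have mfn : measurable_fun `[a, b] (f n).
    by apply: measurable_funTS; exact: continuous_measurable_fun.
  exact/measurable_EFinP.
have mh' : measurable_fun `[a, b] (EFin \o h) by exact/measurable_EFinP.
have ff : {ae mu, forall x, `[a, b]%classic x -> (EFin \o f n) x @[n --> \oo] --> (EFin \o h) x}.
  have Nab : mu.-negligible (N `|` ([set a] `|` [set b])).
    apply: negligibleU => //; apply: negligibleU; apply/negligibleP => //;
      exact: lebesgue_measure_set1.
  apply: negligibleS Nab => x /= /not_implyP[]; rewrite in_itv/= => /andP[ax xb] nx.
  apply: contrapT => /not_orP[nN /not_orP[/= xa xb']]; apply: nx.
  have xab : x \in `]a, b[.
    by rewrite in_itv/= !lt_neqAle ax xb !andbT; apply/andP; split;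
      apply/eqP => E; [apply: xa|apply: xb'].
  have /is_derive1_caratheodory [q [qE qC <-]] := wh _ xab nN.
  have fq n : f n x = q (x + u n).
    by rewrite /f qE [x + _]addrC addrK mulrC mulfK// gt_eqF.
  have xu : x + u n @[n --> \oo] --> x.
    by rewrite -[X in _ --> X]addr0; apply: cvgD => //; exact: cvg_cst.
  have qu : f n x @[n --> \oo] --> q x.
    by under eq_fun do rewrite fq; exact: (cvg_comp _ _ xu qC).
  by apply: cvg_EFin => //; exact: nearW.
have ig : mu.-integrable `[a, b] (EFin \o cst `|K|).
  by apply: continuous_integrable; exact: cst_continuous.
have fg : {ae mu, forall x n, `[a, b]%classic x ->
    (`|(EFin \o f n) x| <= (EFin \o cst `|K|%R) x)%E}.
  apply: nearW => x n _; rewrite /f /= lee_fin normrM gtr0_norm ?invr_gt0//.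
  rewrite ler_pdivrMl// (le_trans (wK _ _))// [x + _]addrC addrK [`|u n|]gtr0_norm//.
  by rewrite mulrC ler_wpM2l ?ler_norm// ltW.
have [ih _ dc] := @dominated_convergence _ (measurableTypeR R) _ mu `[a, b]%classic
  (measurable_itv _) (fun n => EFin \o f n) _ _ mf_ mh' ff ig fg.
have /fine_cvg dc' : (\int[mu]_(x in `[a, b]) (f n x)%:E)%E @[n --> \oo] -->
    (fine (\int[mu]_(x in `[a, b]) (h x)%:E)%E)%:E.
  rewrite fineK; first exact: dc.
  by apply: integrable_fin_num; [exact: measurable_itv|exact: ih].
exact: (cvg_unique _ dc' lim1).
Qed.

End lipschitz_ftc.

(** * Fubini's theorem on a triangle *)

Section fubini_indic.
Context d (T : measurableType d) (R : realType).
Variable m : {sigma_finite_measure set T -> \bar R}.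

Lemma integrableM_indic (f : T -> R) (A : set T) : measurable A ->
  m.-integrable setT (EFin \o f) -> m.-integrable setT (EFin \o (fun t => f t * \1_A t)).
Proof.
move=> mA fi; have mf := measurable_int m fi.
apply: (le_integrable measurableT _ _ fi).
  apply/measurable_EFinP; apply: measurable_funM; last exact: measurable_indic.
  exact/measurable_EFinP.
move=> t _ /=; rewrite lee_fin normrM -[leRHS]mulr1 ler_wpM2l// indicE.
by case: (_ \in _); rewrite ?normr1 ?normr0.
Qed.

(** The indicator of [A] couples the two variables; the integrand is dominated by
    the product of [|f|] and [|h|], which is integrable. *)
Lemma Fubini_indic (f h : T -> R) (A : set (T * T)) : measurable A ->
  m.-integrable setT (EFin \o f) -> m.-integrable setT (EFin \o h) ->
  \int[m]_x (f x * \int[m]_t (h t * \1_A (x, t))) =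
  \int[m]_t (h t * \int[m]_x (f x * \1_A (x, t))).
Proof.
move=> mA fi hi.
have mf : measurable_fun setT f by apply/measurable_EFinP; exact: measurable_int fi.
have mh : measurable_fun setT h by apply/measurable_EFinP; exact: measurable_int hi.
pose F (z : T * T) := ((f z.1 * h z.2) * \1_A z)%:E.
have mFR : measurable_fun setT (fun z : T * T => f z.1 * h z.2).
  apply: measurable_funM; first exact: measurableT_comp mf _.
  exact: measurableT_comp mh _.
have mF : measurable_fun setT F.
  by apply/measurable_EFinP; apply: measurable_funM mFR _; exact: measurable_indic.
have iF : (m \x m)%E.-integrable setT F.
  apply/(@integrable12ltyP _ _ _ _ _ m m F mF).
  have [mh' hoo] := integrableP _ _ _ hi; have [mf' foo] := integrableP _ _ _ fi.
  pose H := (\int[m]_t `|(EFin \o h) t|)%E.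
  have H0 : (0 <= H)%E by exact: integral_ge0.
  apply: (@le_lt_trans _ _ (\int[m]_x (H * `|(EFin \o f) x|))%E); last first.
    rewrite ge0_integralZl//; last exact: measurableT_comp.
    by apply: lte_mul_pinfty => //; rewrite ge0_fin_numE.
  apply: ge0_le_integral => //.
  - by move=> x _; exact: integral_ge0.
  - by apply: (measurable_fun_fubini_tonelli_F (abse \o F)) => //=; exact: measurableT_comp.
  - by apply: measurable_funeM; exact: measurableT_comp.
  move=> x _; rewrite muleC -ge0_integralZl//; last exact: measurableT_comp.
  apply: ge0_le_integral => //.
  - by apply: measurableT_comp => //; exact: measurable_fun_pair2.
  - by apply: measurable_funeM; exact: measurableT_comp.
  move=> t _; rewrite /F /= -EFinM lee_fin !normrM -[leRHS]mulr1 ler_wpM2l// indicE.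
  by case: (_ \in _); rewrite ?normr1 ?normr0.
have inner (k l : T -> R) (C : set T) x : measurable C -> m.-integrable setT (EFin \o l) ->
    (\int[m]_t (k x * l t * \1_C t)%:E)%E = (k x * \int[m]_t (l t * \1_C t))%:E.
  move=> mC li; have lCi := integrableM_indic mC li.
  under eq_integral do rewrite -mulrA EFinM.
  rewrite integralZl// EFinM /Rintegral fineK//; exact: integrable_fin_num.
have indx x t : \1_A (x, t) = \1_(xsection A x) t :> R by rewrite !indicE mem_xsection.
have indy x t : \1_A (x, t) = \1_(ysection A t) x :> R by rewrite !indicE mem_ysection.
have Ex x : (\int[m]_t F (x, t) = (f x * \int[m]_t (h t * \1_A (x, t)))%:E)%E.
  under [in RHS]eq_Rintegral do rewrite indx.
  rewrite -inner//; last exact: measurable_xsection.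
  by apply: eq_integral => t _; rewrite /F/= indx.
have Ey t : (\int[m]_x F (x, t) = (h t * \int[m]_x (f x * \1_A (x, t)))%:E)%E.
  under [in RHS]eq_Rintegral do rewrite indy.
  rewrite -inner//; last exact: measurable_ysection.
  by apply: eq_integral => x _; rewrite /F/= indy [f x * _]mulrC.
apply: (congr1 fine).
under eq_integral do rewrite -Ex.
under [in RHS]eq_integral do rewrite -Ey.
exact: Fubini.
Qed.

End fubini_indic.

Section fubini_triangle.
Context {R : realType}.

Lemma measurable_ltr_cara : measurable [set z : cara R * cara R | (z.1 : R) < z.2].
Proof.
have m1 : measurable_fun setT (fun z : cara R * cara R => z.1 : R).
  by apply: (measurableT_comp measurable_id_cara); exact: measurable_fst.
have m2 : measurable_fun setT (fun z : cara R * cara R => z.2 : R).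
  by apply: (measurableT_comp measurable_id_cara); exact: measurable_snd.
have := measurable_fun_ltr m1 m2 measurableT (Y := [set true]) I.
rewrite setTI; congr (measurable _); apply/seteqP; split => z //=.
Qed.

(** An integration by parts for integrals of integrable functions: both sides are
    the integral of [f x * h t] over the triangle [a < x < t < b]. *)
Lemma Rintegral_Fubini_triangle (a b : R) (f h : R -> R) :
  (leb R).-integrable `]a, b[ (EFin \o f) -> (leb R).-integrable `]a, b[ (EFin \o h) ->
  \int[leb R]_(x in `]a, b[) (f x * \int[leb R]_(t in `]x, b[) h t) =
  \int[leb R]_(t in `]a, b[) (h t * \int[leb R]_(x in `]a, t[) f x).
Proof.
have mab : measurable (`]a, b[%classic : set (cara R)) by exact: measurable_cara.
move=> fi hi.
have {}fi : (leb R).-integrable setT (EFin \o (f \_ `]a, b[)).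
  rewrite -restrict_EFin; exact: ((integrable_mkcond _ mab).1 fi).
have {}hi : (leb R).-integrable setT (EFin \o (h \_ `]a, b[)).
  rewrite -restrict_EFin; exact: ((integrable_mkcond _ mab).1 hi).
have indic_lt x t : \1_[set z : cara R * cara R | (z.1 : R) < z.2] (x, t) = ((x : R) < t)%R%:R :> R.
  rewrite indicE (_ : ((x, t) \in _) = ((x : R) < t)%R)//.
  by apply/idP/idP; rewrite inE.
have FE := Fubini_indic measurable_ltr_cara fi hi.
rewrite [LHS]Rintegral_mkcond [RHS]Rintegral_mkcond.
transitivity (\int[leb R]_x ((f \_ `]a, b[) x * \int[leb R]_t
   ((h \_ `]a, b[) t * \1_[set z : cara R * cara R | (z.1 : R) < z.2] (x, t)))).
  apply: eq_Rintegral => x _; rewrite !patchE; case: ifPn => [|_]; last by rewrite mul0r.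
  rewrite inE/= in_itv/= => /andP[ax xb]; congr (_ * _).
  rewrite [LHS]Rintegral_mkcond; apply: eq_Rintegral => t _.
  rewrite !patchE indic_lt !mem_setE !in_itv/=.
  case: (ltP x t) => xt /=; last by rewrite mulr0.
  by rewrite (lt_trans ax xt) mulr1.
rewrite FE.
apply: eq_Rintegral => t _; rewrite !patchE; case: ifPn => [|_]; last by rewrite mul0r.
rewrite inE/= in_itv/= => /andP[ax xb]; congr (_ * _).
rewrite [RHS]Rintegral_mkcond; apply: eq_Rintegral => x _.
rewrite !patchE indic_lt !mem_setE !in_itv/=.
case: (ltP x t) => xt /=; last by rewrite andbF mulr0.
by rewrite (lt_trans xt xb) mulr1.
Qed.

End fubini_triangle.

(** * Smooth steps and approximations of the Dirac mass *)

Section step.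
Context {R : realType}.
Implicit Types (t z x y e : R).

(** A differentiability criterion without case analysis, suited to functions
    that are only piecewise polynomial. *)
Lemma is_derive_quadratic (f : R -> R) t l (C : R) : 0 <= C ->
  (forall z, `|f z - f t - l * (z - t)| <= C * (z - t) ^+ 2) -> is_derive t 1 f l.
Proof.
move=> C0 fC; have C1 : 0 < C + 1 by rewrite ltr_wpDl.
apply/is_derive1_caratheodory.
exists (fun z => if z == t then l else (f z - f t) / (z - t)); split.
- move=> z; case: eqVneq => [->|zt]; first by rewrite !subrr mulr0.
  by rewrite divfK// subr_eq0.
- rewrite /prop_for /continuous_at eqxx; apply/cvgrPdist_le => e0 e00; near=> z.
  case: eqVneq => [_|zt]; first by rewrite subrr normr0 ltW.
  have zt0 : 0 < `|z - t| by rewrite normr_gt0 subr_eq0.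
  rewrite [X in X <= _]distrC -(ler_pM2r zt0) -normrM mulrBl divfK ?subr_eq0//.
  rewrite (le_trans (fC z))// -real_normK ?num_real// expr2 mulrA ler_pM2r//.
  apply: (@le_trans _ _ ((C + 1) * `|z - t|)); first by rewrite ler_wpM2r// lerDl.
  rewrite mulrC -ler_pdivlMr// distrC; near: z.
  by exists (e0 / (C + 1)) => /=; [exact: divr_gt0|move=> z /= /ltW].
- by rewrite eqxx.
Unshelve. all: by end_near. Qed.

Definition pos_part t : R := Num.max t 0.
(** [smooth_step] is the integral of the tent function [hat] of support [0, 2]: a
    second difference of [pos_part ^ 2 / 2], which is of class C^1. So it rises
    from [0] to [1] on [0, 2]. *)
Definition smooth_step t : R :=
  (pos_part t ^+ 2 - 2 * pos_part (t - 1) ^+ 2 + pos_part (t - 2) ^+ 2) / 2.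
Definition hat t : R := pos_part t - 2 * pos_part (t - 1) + pos_part (t - 2).

Lemma pos_part_quadratic t z :
  0 <= pos_part z ^+ 2 - pos_part t ^+ 2 - 2 * pos_part t * (z - t) <= (z - t) ^+ 2.
Proof.
have := sqr_ge0 (z - t); have := sqr_ge0 z; have := sqr_ge0 t; rewrite /pos_part.
case: (leP t 0) => t0; case: (leP z 0) => z0 *; apply/andP; split; try lra.
- by have := mulr_ge0_le0 (ltW z0) t0; lra.
- by have := mulr_ge0_le0 (ltW t0) z0; lra.
Qed.

Lemma pos_part_continuous : continuous pos_part.
Proof.
apply: (@lipschitz_continuous _ _ 1) => x y; rewrite mul1r /pos_part.
have := normr_ge0 (x - y); have := ler_norm (x - y); have := ler_norm (y - x).
rewrite distrC; move: `|x - y| => n.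
by move=> ? ? ?; case: (leP x 0) => x0; case: (leP y 0) => y0;
  rewrite ler_norml; apply/andP; split; lra.
Qed.

Lemma hat_continuous : continuous hat.
Proof.
have c k : continuous (fun t => pos_part (t - k)).
  move=> t; have ct : (z - k) @[z --> t] --> t - k.
    by apply: cvgB; [exact: cvg_id|exact: cvg_cst].
  exact: (cvg_comp _ _ ct (@pos_part_continuous (t - k))).
move=> t; apply: cvgD; last exact: (@c 2 t).
apply: cvgB; first exact: (@pos_part_continuous t).
by apply: cvgM; [exact: cvg_cst|exact: (@c 1 t)].
Qed.

Lemma smooth_step_quadratic t z :
  `|smooth_step z - smooth_step t - hat t * (z - t)| <= 2 * (z - t) ^+ 2.
Proof.
have := pos_part_quadratic t z; have := pos_part_quadratic (t - 1) (z - 1).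
have := pos_part_quadratic (t - 2) (z - 2); rewrite /smooth_step /hat.
rewrite !(_ : forall k, z - k - (t - k) = z - t); [|by move=> k; ring..].
move: (pos_part _) (pos_part _) (pos_part _) => p1 p2 p3.
move: (pos_part _) (pos_part _) (pos_part _) => p4 p5 p6.
move=> /andP[? ?] /andP[? ?] /andP[? ?].
by rewrite ler_norml; apply/andP; split; lra.
Qed.

Lemma smooth_step_le0 t : t <= 0 -> smooth_step t = 0.
Proof. by move=> t0; rewrite /smooth_step /pos_part !max_r//; [ring|lra..]. Qed.

Lemma smooth_step_ge2 t : 2 <= t -> smooth_step t = 1.
Proof. by move=> t2; rewrite /smooth_step /pos_part !max_l//; [field|lra..]. Qed.

Lemma smooth_step_itv t : 0 <= smooth_step t <= 1.
Proof.
rewrite /smooth_step /pos_part; case: (leP t 0) => t0; case: (leP (t - 1) 0) => t1;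
  case: (leP (t - 2) 0) => t2; apply/andP; split; nra.
Qed.

Lemma hat_ge0 t : 0 <= hat t.
Proof.
by rewrite /hat /pos_part; case: (leP t 0) => t0; case: (leP (t - 1) 0) => t1;
  case: (leP (t - 2) 0) => t2; lra.
Qed.

Lemma hat_support t : hat t != 0 -> 0 <= t <= 2.
Proof.
move=> ht; apply/andP; split; rewrite leNgt; apply: contra ht => ht; apply/eqP;
  by rewrite /hat /pos_part; case: (leP t 0) => t0; case: (leP (t - 1) 0) => t1;
  case: (leP (t - 2) 0) => t2; lra.
Qed.

(** The step transported to the interval from [y - k e] to [y + (2 - k) e]. *)
Definition ramp e y k t : R := smooth_step ((t - y) / e + k).

Lemma is_derive_ramp e y k t : 0 < e ->
  is_derive t 1 (ramp e y k) (hat ((t - y) / e + k) / e).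
Proof.
move=> e0; apply: (@is_derive_quadratic _ _ _ (2 / e ^+ 2)) => [|z].
  by rewrite divr_ge0// sqr_ge0.
have := smooth_step_quadratic ((t - y) / e + k) ((z - y) / e + k).
rewrite (_ : (z - y) / e + k - ((t - y) / e + k) = (z - t) / e); last by ring.
by rewrite /ramp mulrA [X in `|_ - X|]mulrAC expr_div_n mulrA [X in _ <= X -> _]mulrAC.
Qed.

Lemma ramp_derive_continuous e y k : continuous (fun t => hat ((t - y) / e + k) / e).
Proof.
move=> t; apply: cvgM; last exact: cvg_cst.
have ct : ((z - y) / e + k) @[z --> t] --> (t - y) / e + k.
  apply: cvgD; last exact: cvg_cst.
  by apply: cvgM; [apply: cvgB; [exact: cvg_id|exact: cvg_cst]|exact: cvg_cst].
exact: (cvg_comp _ _ ct (@hat_continuous _)).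
Qed.

Lemma ramp_mass e y k x1 x2 : 0 < e -> x1 < x2 ->
  (x1 - y) / e + k <= 0 -> 2 <= (x2 - y) / e + k ->
  \int[mu]_(t in `[x1, x2]) (hat ((t - y) / e + k) / e) = 1.
Proof.
move=> e0 x12 h1 h2.
have der t := is_derive_ramp y k t e0.
have dE : derive1 (ramp e y k) = (fun t => hat ((t - y) / e + k) / e).
  by apply/funext => t; rewrite derive1E; exact: derive_val.
have cr : continuous (ramp e y k).
  by move=> t; apply/differentiable_continuous; rewrite -derivable1_diffP; have [] := der t.
rewrite /Rintegral (@continuous_FTC2 _ _ (ramp e y k))//=.
- by rewrite /ramp (smooth_step_le0 h1) (smooth_step_ge2 h2) subr0.
- exact/continuous_subspaceT/ramp_derive_continuous.
- split.
  + by move=> t _; have [] := der t.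
  + by apply: cvg_at_right_filter; exact: (@cr x1).
  + by apply: cvg_at_left_filter; exact: (@cr x2).
- by rewrite dE.
Qed.

(** Nonnegative kernels of mass one that concentrate at [y]. Only continuity of [v]
    relative to the segment is available, [y] being possibly an end point. *)
Lemma cvg_kernel (a b y : R) (v : R -> R) (k : nat -> R -> R) (r : R^nat) :
  a <= y <= b -> {within `[a, b], continuous v} ->
  (forall n, continuous (k n)) -> (forall n t, 0 <= k n t) ->
  (forall n t, t \in `[a, b] -> k n t != 0 -> `|t - y| <= r n) ->
  r @ \oo --> 0 ->
  (forall n, \int[mu]_(t in `[a, b]) k n t = 1) ->
  \int[mu]_(t in `[a, b]) (v t * k n t) @[n --> \oo] --> v y.
Proof.
move=> yab cv ck k0 kr r0 k1; apply/cvgrPdist_le => e e0.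
have /subspace_continuousP/(_ y) := cv.
rewrite /= in_itv/= yab => /(_ isT)/cvgrPdist_le/(_ e e0).
rewrite near_withinE => -[dl /= dl0 Hd].
near=> n.
have rn : r n < dl.
  rewrite (le_lt_trans (ler_norm _))// -[X in `|X|]subr0 distrC; near: n.
  by apply: cvgr_dist_lt.
have vk t : t \in `[a, b] -> k n t != 0 -> `|v y - v t| <= e.
  move=> tab kt; apply: Hd => //=; rewrite distrC.
  exact: le_lt_trans (kr n t tab kt) rn.
have ik : mu.-integrable `[a, b] (EFin \o k n) by exact: continuous_integrable.
have ivk : mu.-integrable `[a, b] (EFin \o (fun t => v t * k n t)).
  apply: continuous_compact_integrable; first exact: segment_compact.
  by move=> t; apply: cvgM; [exact: cv|exact: (continuous_subspaceT (ck n))].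
have ick c : mu.-integrable `[a, b] (EFin \o (fun t => c * k n t)).
  by apply: continuous_integrable => t; apply: cvgM; [exact: cvg_cst|exact: ck].
have H1 : \int[mu]_(t in `[a, b]) (v t * k n t) <= v y + e.
  rewrite -[leRHS]mulr1 -(k1 n) -RintegralZl//; apply: le_Rintegral => //.
  move=> t tab; have [->|kt] := eqVneq (k n t) 0; first by rewrite !mulr0.
  by rewrite ler_wpM2r//; have := vk t tab kt; rewrite ler_distlC => /andP[]; lra.
have H2 : v y - e <= \int[mu]_(t in `[a, b]) (v t * k n t).
  rewrite -[leLHS]mulr1 -(k1 n) -RintegralZl//; apply: le_Rintegral => //.
  move=> t tab; have [->|kt] := eqVneq (k n t) 0; first by rewrite !mulr0.
  by rewrite ler_wpM2r//; have := vk t tab kt; rewrite ler_distlC => /andP[]; lra.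
by rewrite ler_distlC; apply/andP; split; lra.
Unshelve. all: by end_near. Qed.

End step.

(** * Functions of class H^1 are integrals of their weak derivatives *)

Section primitive.
Context {R : realType}.
Implicit Types (a b x : R) (v z : R -> R).

Lemma L2_integrable a b z : L2 a b z -> (leb R).-integrable `]a, b[ (EFin \o z).
Proof.
move=> [mz iz]; have mab : measurable (`]a, b[%classic : set (cara R)) by exact: measurable_cara.
have i1 : (leb R).-integrable `]a, b[ (EFin \o cst 1).
  by apply: continuous_integrable_leb; exact: cst_continuous.
apply: (le_integrable mab _ _ (integrableD mab i1 iz)).
  exact/measurable_EFinP.
move=> x _ /=; rewrite lee_fin [leRHS]ger0_norm ?addr_ge0 ?sqr_ge0//.
rewrite -[z x ^+ 2]real_normK ?num_real//.
by have := sqr_ge0 (`|z x| - 1); nra.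
Qed.

(** For small [e], this rises on [a + e, a + 3 e], equals [1] up to [x - 3 e], and
    vanishes again from [x - e] on: a C^1 approximation of the indicator of [a, x]
    with support inside. *)
Definition cutoff e a x (t : R) : R := ramp e a (-1) t - ramp e x 3 t.

Lemma cutoff_test e a x b : 0 < e -> 4 * e <= x - a -> x <= b -> test_function a b (cutoff e a x).
Proof.
move=> e0 eax xb.
have der t := is_deriveB (is_derive_ramp a (-1) t e0) (is_derive_ramp x 3 t e0).
have dE : derive1 (cutoff e a x) =
    (fun t => hat ((t - a) / e + -1) / e - hat ((t - x) / e + 3) / e).
  by apply/funext => t; rewrite derive1E; exact: derive_val.
split.
- by move=> t; have [] := der t.
- by rewrite dE => t; apply: cvgB; exact: ramp_derive_continuous.
- apply: (@subset_trans _ `[a + e, x - e]%classic).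
    rewrite [X in _ `<=` X](closure_id _).1; last exact: interval_closed.
    apply: closure_subset => t /= ct; rewrite in_itv/=.
    apply/andP; split; rewrite leNgt; apply: contra ct => tx; apply/eqP.
      rewrite /cutoff /ramp !smooth_step_le0 ?subrr//.
        have : (t - x) / e <= - 3 by rewrite ler_pdivrMr//; lra.
        lra.
      have : (t - a) / e <= 1 by rewrite ler_pdivrMr//; lra.
      lra.
    rewrite /cutoff /ramp !smooth_step_ge2 ?subrr//.
      have : -1 <= (t - x) / e by rewrite ler_pdivlMr//; lra.
      lra.
    have : 3 <= (t - a) / e by rewrite ler_pdivlMr//; lra.
    lra.
  move=> t /=; rewrite !in_itv/= => /andP[at' tx]; apply/andP; split; lra.
Qed.

(** Test the definition of the weak derivative with [cutoff e a x] and let [e] tend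
    to [0]. The derivative of the cutoff is a kernel concentrating at [a] minus a
    kernel concentrating at [x], so one side tends to [v a - v x]; by dominated
    convergence the other one tends to minus the integral of [z] over [a, x]. *)
Lemma H1_primitive a b v z : a < b -> {within `[a, b], continuous v} -> H1_deriv a b v z ->
  forall x, a < x -> x <= b -> v x - v a = \int[leb R]_(t in `]a, x[) z t.
Proof.
move=> ab cv [_ L2z wd] x ax xb.
(* n + 4 ensures 4 e <= x - a, hence that the cutoff is supported in
   [a + e, x - e]. *)
pose e n : R := (x - a) / n.+4%:R.
have e0 n : 0 < e n by rewrite divr_gt0// subr_gt0.
have e_0 : e @ \oo --> 0.
  rewrite -[X in _ --> X](mulr0 (x - a)); apply: cvgM; first exact: cvg_cst.
  have := @cvg_harmonic R; rewrite -(cvg_shiftn 3).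
  by under eq_fun do rewrite addn3.
have e4 n : 4 * e n <= x - a.
  rewrite /e mulrA ler_pdivrMr// mulrC ler_pM2l ?subr_gt0//.
  by rewrite ler_nat.
have tf n : test_function a b (cutoff (e n) a x) by exact: cutoff_test.
have dE n : derive1 (cutoff (e n) a x) =
    (fun t => hat ((t - a) / e n + -1) / e n - hat ((t - x) / e n + 3) / e n).
  apply/funext => t; rewrite derive1E.
  have der := is_deriveB (is_derive_ramp a (-1) t (e0 n)) (is_derive_ramp x 3 t (e0 n)).
  exact: derive_val.
pose k1 n t := hat ((t - a) / e n + -1) / e n.
pose k2 n t := hat ((t - x) / e n + 3) / e n.
have k_le n y k t : hat ((t - y) / e n + k) / e n != 0 -> - k * e n <= t - y <= (2 - k) * e n.
  rewrite mulf_eq0 negb_or => /andP[/hat_support/andP[h1 h2] _].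
  have h3 : (t - y) / e n * e n = t - y by rewrite divfK// gt_eqF.
  by rewrite -h3 !ler_pM2r//; apply/andP; split; lra.
have r0 : (fun n => 3 * e n) @ \oo --> 0.
  by rewrite -[X in _ --> X](mulr0 3); apply: cvgM => //; exact: cvg_cst.
have l1 : \int[mu]_(t in `[a, b]) (v t * k1 n t) @[n --> \oo] --> v a.
  apply: (@cvg_kernel _ a b a v k1 _ _ cv _ _ _ r0).
  - by rewrite lexx ltW.
  - by move=> n; exact: ramp_derive_continuous.
  - by move=> n t; rewrite divr_ge0 ?hat_ge0// ltW.
  - move=> n t _ /k_le/andP[? ?]; rewrite ler_norml; have := e0 n.
    by move=> ?; apply/andP; split; lra.
  - move=> n; apply: ramp_mass => //.
      by rewrite subrr mul0r; lra.
    have : 3 <= (b - a) / e n by rewrite ler_pdivlMr//; have := e4 n; have := e0 n; lra.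
    lra.
have l2 : \int[mu]_(t in `[a, b]) (v t * k2 n t) @[n --> \oo] --> v x.
  apply: (@cvg_kernel _ a b x v k2 _ _ cv _ _ _ r0).
  - by rewrite xb ltW.
  - by move=> n; exact: ramp_derive_continuous.
  - by move=> n t; rewrite divr_ge0 ?hat_ge0// ltW.
  - move=> n t _ /k_le/andP[? ?]; rewrite ler_norml; have := e0 n.
    by move=> ?; apply/andP; split; lra.
  - move=> n; apply: ramp_mass => //.
      have : (a - x) / e n <= - 4 by rewrite ler_pdivrMr//; have := e4 n; lra.
      lra.
    have : 0 <= (b - x) / e n by rewrite divr_ge0 ?subr_ge0// ltW.
    lra.
have ivk k : continuous k -> mu.-integrable `[a, b] (EFin \o (fun t => v t * k t)).
  move=> ck; apply: continuous_compact_integrable; first exact: segment_compact.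
  by move=> t; apply: cvgM; [exact: cv|exact: (continuous_subspaceT ck)].
have wdn n : \int[mu]_(t in `[a, b]) (v t * k1 n t) - \int[mu]_(t in `[a, b]) (v t * k2 n t) =
    - \int[leb R]_(t in `]a, b[) (z t * cutoff (e n) a x t).
  rewrite -wd// dE -RintegralB//; [|exact/ivk/ramp_derive_continuous..].
  have ck : continuous (fun t => k1 n t - k2 n t).
    by move=> t; apply: cvgB; exact: ramp_derive_continuous.
  have iv := ivk _ ck.
  rewrite Rintegral_leb//; last first.
    apply/measurable_EFinP; apply: measurable_funS (measurable_int _ iv) => //.
    exact: subset_itv_oo_cc.
  rewrite Rintegral_itv_oo//.
  by apply: eq_Rintegral => t _; rewrite mulrBr.
have lhs : (- \int[leb R]_(t in `]a, b[) (z t * cutoff (e n) a x t)) @[n --> \oo] --> v a - v x.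
  by under eq_fun do rewrite -wdn; exact: cvgB.
have iz := L2_integrable L2z.
have mab : measurable (`]a, b[%classic : set (cara R)) by exact: measurable_cara.
have rhs : \int[leb R]_(t in `]a, b[) (z t * cutoff (e n) a x t) @[n --> \oo] -->
    \int[leb R]_(t in `]a, b[) (z t * \1_(`]a, x[) t).
  have mz : measurable_fun (`]a, b[ : set (cara R)) z by have [] := L2z.
  have mc n : measurable_fun (`]a, b[ : set (cara R)) (cutoff (e n) a x).
    apply: measurable_fun_cara => //; apply: (@measurable_funS _ _ _ _ setT) => //.
    apply: continuous_measurable_fun => t; apply/differentiable_continuous.
    by rewrite -derivable1_diffP; have [] := tf n.
  have mf_ n : measurable_fun (`]a, b[ : set (cara R))
      (EFin \o (fun t => z t * cutoff (e n) a x t)).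
    by apply/measurable_EFinP; exact: measurable_funM.
  have mf : measurable_fun (`]a, b[ : set (cara R)) (EFin \o (fun t => z t * \1_(`]a, x[) t)).
    apply/measurable_EFinP; apply: measurable_funM => //.
    by apply: measurable_fun_cara => //; exact: measurable_indic.
  have ff : {ae leb R, forall t, `]a, b[%classic t ->
      (EFin \o (fun t => z t * cutoff (e n) a x t)) t @[n --> \oo] -->
      (EFin \o (fun t => z t * \1_(`]a, x[) t)) t}.
    apply: nearW => t /=; rewrite in_itv/= => /andP[at' tb].
    apply: cvg_near_cst; have [tx|xt] := ltP t x.
      rewrite indicE mem_set/= ?in_itv/= ?at' ?tx//.
      near=> n; congr (_%:E); congr (_ * _).
      have en1 : e n <= (t - a) / 3.
        rewrite -[leLHS]gtr0_norm// -[`|_|]normrN -sub0r; near: n.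
        by apply: cvgr_dist_le => //; rewrite divr_gt0// subr_gt0.
      have en2 : e n <= (x - t) / 3.
        rewrite -[leLHS]gtr0_norm// -[`|_|]normrN -sub0r; near: n.
        by apply: cvgr_dist_le => //; rewrite divr_gt0// subr_gt0.
      rewrite /cutoff /ramp smooth_step_ge2 ?smooth_step_le0 ?subr0//.
        have : (t - x) / e n <= - 3 by rewrite ler_pdivrMr//; lra.
        lra.
      have : 3 <= (t - a) / e n by rewrite ler_pdivlMr//; lra.
      lra.
    near=> n; congr (_%:E); congr (_ * _).
    rewrite indicE memNset/=; last by rewrite in_itv/= [t < x]ltNge xt/= andbF.
    rewrite /cutoff /ramp !smooth_step_ge2 ?subrr//.
      have : 0 <= (t - x) / e n by rewrite divr_ge0 ?subr_ge0// ltW.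
      lra.
    have : 3 <= (t - a) / e n by rewrite ler_pdivlMr//; have := e4 n; have := e0 n; lra.
    lra.
  have fg : {ae leb R, forall t n, `]a, b[%classic t ->
      (`|(EFin \o (fun t => (z t * cutoff (e n) a x t)%R)) t| <= (abse \o (EFin \o z)) t)%E}.
    apply: nearW => t n _ /=; rewrite lee_fin normrM -[leRHS]mulr1 ler_wpM2l//.
    rewrite /cutoff /ramp; have := smooth_step_itv ((t - a) / e n + -1).
    by have := smooth_step_itv ((t - x) / e n + 3); rewrite ler_norml; lra.
  have [ih _ dc] := @dominated_convergence _ (cara R) _ (leb R) `]a, b[%classic mab
    (fun n => EFin \o (fun t => z t * cutoff (e n) a x t)) _ _ mf_ mf ff (integrable_abse iz) fg.
  apply: fine_cvg; rewrite fineK; first exact: dc.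
  exact: (integrable_fin_num mab ih).
have : v a - v x = - \int[leb R]_(t in `]a, b[) (z t * \1_(`]a, x[) t).
  exact: (cvg_unique _ lhs (cvgN rhs)).
move=> E; rewrite -opprB E opprK.
rewrite [LHS]Rintegral_mkcond [RHS]Rintegral_mkcond; apply: eq_Rintegral => t _.
rewrite !patchE indicE !mem_setE !in_itv/=; case: (ltP t x) => tx; rewrite ?andbF ?andbT.
  by rewrite (lt_le_trans tx xb) andbT; case: (a < t); rewrite ?mulr1.
by case: ifP; rewrite ?mulr0.
Unshelve. all: by end_near.
Qed.

End primitive.

(** * From an integrated equation to weak solutions *)

Section weak.
Context {R : realType}.
Implicit Types (a b : R) (u v w z g h : R -> R).

Lemma continuous_L2 a b f : continuous f -> L2 a b f.
Proof.
move=> cf; split.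
  apply: measurable_fun_cara => //; apply: (@measurable_funS _ _ _ _ setT) => //.
  exact: continuous_measurable_fun.
by apply: (@continuous_integrable_leb _ _ _ (fun x => f x ^+ 2)) => x; apply: cvgM; exact: cf.
Qed.

Lemma test_function_out a b phi x : test_function a b phi -> x \notin `]a, b[ -> phi x = 0.
Proof.
move=> [_ _ supp] xab; apply: contraNeq xab => px.
by apply: supp; exact: subset_closure.
Qed.

Lemma C1_H1_deriv a b u w : a < b -> continuous u -> continuous w ->
  (forall x, x \in `]a, b[ -> is_derive x 1 u (w x)) -> H1_deriv a b u w.
Proof.
move=> ab cu cw du; split; [exact: continuous_L2|exact: continuous_L2|].
move=> phi tphi; have [dphi cphi' _] := tphi.
have cphi : continuous phi.
  by move=> x; apply/differentiable_continuous; rewrite -derivable1_diffP.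
rewrite Rintegral_leb_oo; last first.
  by apply: continuous_integrable => x; apply: cvgM; [exact: cu|exact: cphi'].
rewrite Rintegral_leb_oo; last first.
  by apply: continuous_integrable => x; apply: cvgM; [exact: cw|exact: cphi].
rewrite (@Rintegration_by_parts _ u phi w (derive1 phi) a b ab).
- rewrite !(test_function_out tphi) ?in_itv/= ?ltxx ?andbF//.
  by rewrite !mulr0 subrr sub0r.
- exact: continuous_subspaceT.
- split.
  + by move=> x xab; have [] := du x xab.
  + by apply: cvg_at_right_filter; exact: (cu a).
  + by apply: cvg_at_left_filter; exact: (cu b).
- by move=> x xab; rewrite derive1E; have dx := du x xab; exact: derive_val.
- exact: continuous_subspaceT.
- split.
  + by move=> x _; exact: dphi.
  + by apply: cvg_at_right_filter; exact: (cphi a).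
  + by apply: cvg_at_left_filter; exact: (cphi b).
- by [].
Qed.

(** Replace [v t] by the integral of [z] over [a, t] and [w x] by the integral of
    [lambda * h u] over [x, b]: the weak equation becomes the equality of the two
    iterated integrals over a triangle. The Borel function [h] stands for [g],
    from which it differs on a null set along [u]. *)
Lemma weak_solutionP a b g h lambda u w (C : R) : a < b ->
  continuous u -> continuous w -> u a = 0 ->
  (forall x, x \in `]a, b[ -> is_derive x 1 u (w x)) ->
  measurable_fun [set: R] h -> (forall x, `|h (u x)| <= C) ->
  mu.-negligible (`]a, b[ `&` [set x | g (u x) <> h (u x)]) ->
  (forall x, x \in `[a, b] -> \int[mu]_(t in `[x, b]) (lambda * h (u t)) = w x) ->
  weak_solution a b g lambda u.
Proof.
move=> ab cu cw ua du mh hC gh wE.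
have uw := C1_H1_deriv ab cu cw du.
split; first by split; [exists w|exact: continuous_subspaceT|].
exists w => // v z [_ cv va] vz.
have mab : measurable (`]a, b[%classic : set (cara R)) by exact: measurable_cara.
have [L2v L2z _] := vz.
have iv := L2_integrable L2v; have iz := L2_integrable L2z.
have mhu : measurable_fun [set: R] (fun x => h (u x)).
  by apply: measurableT_comp => //; exact: continuous_measurable_fun.
have mhu_ab : measurable_fun (`]a, b[ : set (cara R)) (fun x => h (u x)).
  by apply: measurable_fun_cara => //; exact: measurable_funTS.
have mv : measurable_fun (`]a, b[ : set (cara R)) v by have [] := L2v.
have C0 : 0 <= C by exact: le_trans (hC a).
have ihv : (leb R).-integrable `]a, b[ (fun x => (h (u x) * v x)%:E).
  apply: (le_integrable mab _ _ (integrableZl mab C iv)).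
    by apply/measurable_EFinP; exact: measurable_funM.
  move=> x _ /=; rewrite lee_fin !normrM ler_wpM2r// (le_trans (hC x))//.
  exact: ler_norm.
have ghv : {ae leb R, forall x, `]a, b[%classic x -> h (u x) * v x = g (u x) * v x}.
  apply/leb_negligible; apply: negligibleS gh => x /= /not_implyP[xab ne]; split => //.
  by move=> E; apply: ne; rewrite E.
split; first exact: (ae_eq_integrable_leb mab ghv ihv).
rewrite -(ae_eq_Rintegral_leb mab ghv (measurable_int _ ihv)).
have ih x y : mu.-integrable `[x, y] (EFin \o (fun t => lambda * h (u t))).
  apply: (@bounded_integrable _ _ _ _ (`|lambda| * C)).
    by apply: measurable_funM; [exact: measurable_cst|exact: measurable_funTS].
  by move=> t _; rewrite normrM ler_wpM2l.
have ihl : (leb R).-integrable `]a, b[ (EFin \o (fun t => lambda * h (u t))).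
  apply: integrable_leb => //.
  by apply: integrableS (ih a b) => //; exact: subset_itv_oo_cc.
have := Rintegral_Fubini_triangle iz ihl.
have -> : \int[leb R]_(x in `]a, b[) (z x * \int[leb R]_(t in `]x, b[) (lambda * h (u t))) =
    \int[leb R]_(x in `]a, b[) (w x * z x).
  apply: eq_Rintegral => x; rewrite inE/= in_itv/= => /andP[ax xb].
  by rewrite Rintegral_leb_oo// wE 1?mulrC// in_itv/= !ltW.
move=> ->.
rewrite -RintegralZl//.
apply: eq_Rintegral => x; rewrite inE/= in_itv/= => /andP[ax xb].
by rewrite -(H1_primitive ab cv vz ax (ltW xb)) va subr0 mulrA.
Qed.

End weak.

(** * The time map *)

(** [P] behaves like the primitive, started at [0], of a function between [m] and
    [B K] on [0, K]. It is extended by [0] on the left so that [slowness] is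
    continuous at every positive [q], also beyond [1]. *)
Definition potential {R : realType} (P B : R -> R) (m : R) : Prop :=
  [/\ 0 < m, continuous P, (forall t, t <= 0 -> P t = 0),
      (forall x y, 0 <= x -> x <= y -> m * (y - x) <= P y - P x) &
      (forall K x y, 0 <= x -> x <= y -> y <= K -> P y - P x <= B K * (y - x))].

Section time_map_def.
Context {R : realType}.
Variable P : R -> R.
(** The parameter [q] stands for the height [M * (1 - q ^ 2)]. For the trajectory
    of amplitude [M], [energy_drop] is the square of the speed at this height,
    [slowness] the absolute value of the derivative of the time with respect to
    [q], and [time_map M q] the time needed to climb from the height with
    parameter [q] to the top. The change of variables removes the singularity of
    [1 / speed] at the top. *)
Definition energy_drop M q := P M - P (M * (1 - q ^+ 2)).
Definition slowness M q := 2 * M * q / Num.sqrt (energy_drop M q).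
Definition time_map M q := \int[mu]_(t in `[0, q]) slowness M t.
End time_map_def.

Section time_map_theory.
Context {R : realType}.
Variables (P B : R -> R) (m : R).
Hypothesis hP : potential P B m.
Let m_gt0 : 0 < m. Proof. by case: hP. Qed.
Let cP : continuous P. Proof. by case: hP. Qed.
Let P_le0 t : t <= 0 -> P t = 0. Proof. by case: hP => _ _ + _ _; exact. Qed.
Let P_ge x y : 0 <= x -> x <= y -> m * (y - x) <= P y - P x.
Proof. by case: hP => _ _ _ + _; exact. Qed.
Let P_le x y : 0 <= x -> x <= y -> P y - P x <= B y * (y - x).
Proof. by case: hP => _ _ _ _ + x0 xy; exact. Qed.
Local Notation energy_drop := (energy_drop P).
Local Notation slowness := (slowness P).
Local Notation time_map := (time_map P).
Implicit Types (M q t x y : R).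

Lemma potential0 : P 0 = 0. Proof. exact: P_le0. Qed.

Lemma upper_slope_ge M : 0 < M -> m <= B M.
Proof.
move=> M0; have := P_ge (lexx 0) (ltW M0); move/le_trans => /(_ _ (P_le (lexx 0) (ltW M0))).
by rewrite subr0 ler_pM2r.
Qed.

Lemma energy_drop_ge M q : 0 < M -> 0 <= q -> q <= 1 -> m * M * q ^+ 2 <= energy_drop M q.
Proof.
move=> M0 q0 q1; have q2 : q ^+ 2 <= 1 by rewrite expr_le1.
apply: le_trans (P_ge _ _); [lra|apply: mulr_ge0; lra|].
by rewrite -[leRHS]mulr1 ler_pM2l//; have := sqr_ge0 q; lra.
Qed.

Lemma energy_drop_le M q : 0 < M -> 0 <= q -> q <= 1 -> energy_drop M q <= B M * M * q ^+ 2.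
Proof.
move=> M0 q0 q1; have q2 : q ^+ 2 <= 1 by rewrite expr_le1.
apply: le_trans (P_le _ _) _; [apply: mulr_ge0; lra| |lra].
by rewrite -[leRHS]mulr1 ler_pM2l//; have := sqr_ge0 q; lra.
Qed.

Lemma energy_drop_gt0 M q : 0 < M -> 0 < q -> 0 < energy_drop M q.
Proof.
move=> M0 q0; have [q1|q1] := leP q 1.
  by apply: lt_le_trans (energy_drop_ge M0 (ltW q0) q1); rewrite !mulr_gt0// exprn_gt0.
rewrite /energy_drop [X in _ - X]P_le0 ?subr0.
  have := P_ge (lexx 0) (ltW M0); rewrite potential0 !subr0; apply: lt_le_trans.
  exact: mulr_gt0.
rewrite mulr_ge0_le0 ?(ltW M0)// subr_le0 exprn_ege1//; lra.
Qed.

Lemma slowness0 M : slowness M 0 = 0. Proof. by rewrite /slowness mulr0 mul0r. Qed.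

Lemma slowness_gt0 M q : 0 < M -> 0 < q -> 0 < slowness M q.
Proof. by move=> M0 q0; rewrite /slowness divr_gt0 ?sqrtr_gt0 ?energy_drop_gt0// !mulr_gt0. Qed.

Lemma slowness_ge0 M q : 0 < M -> 0 <= q -> 0 <= slowness M q.
Proof.
move=> M0; rewrite le_eqVlt => /predU1P[<-|q0]; first by rewrite slowness0.
exact/ltW/slowness_gt0.
Qed.

(** The square of the speed is at least [m M q ^ 2], which compensates the factor
    [q] coming from the change of variables. *)
Lemma slowness_le M q : 0 < M -> 0 <= q -> q <= 1 -> slowness M q <= 2 * Num.sqrt (M / m).
Proof.
move=> M0; rewrite le_eqVlt => /predU1P[<-|q0] q1.
  by rewrite slowness0 mulr_ge0// sqrtr_ge0.
rewrite ler_pdivrMr ?sqrtr_gt0 ?energy_drop_gt0// -!mulrA ler_pM2l// -sqrtrM; last first.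
  by rewrite divr_ge0// ltW.
rewrite -[leLHS]gtr0_norm ?mulr_gt0// -sqrtr_sqr ler_wsqrtr//.
apply: (@le_trans _ _ (M / m * (m * M * q ^+ 2))).
  by rewrite le_eqVlt; apply/orP; left; apply/eqP; field; rewrite gt_eqF.
by rewrite ler_pM2l ?divr_gt0//; apply: energy_drop_ge => //; exact: ltW.
Qed.

Lemma slowness_ge M q : 0 < M -> 0 < q -> q <= 1 -> 2 * Num.sqrt (M / B M) <= slowness M q.
Proof.
move=> M0 q0 q1; have B0 : 0 < B M by exact: lt_le_trans (upper_slope_ge M0).
rewrite ler_pdivlMr ?sqrtr_gt0 ?energy_drop_gt0// -!mulrA ler_pM2l// -sqrtrM; last first.
  by rewrite divr_ge0// ltW.
rewrite -[leRHS]gtr0_norm ?mulr_gt0// -sqrtr_sqr ler_wsqrtr//.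
apply: (@le_trans _ _ (M / B M * (B M * M * q ^+ 2))); last first.
  by rewrite le_eqVlt; apply/orP; left; apply/eqP; field; rewrite gt_eqF.
by rewrite ler_pM2l ?divr_gt0//; apply: energy_drop_le => //; exact: ltW.
Qed.

Lemma energy_drop_continuous M q : energy_drop z.1 z.2 @[z --> (M, q)] --> energy_drop M q.
Proof.
have c1 : z.1 @[z --> (M, q)] --> M by exact: cvg_fst.
have c2 : z.2 @[z --> (M, q)] --> q by exact: cvg_snd.
have c3 : z.1 * (1 - z.2 ^+ 2) @[z --> (M, q)] --> M * (1 - q ^+ 2).
  by apply: cvgM => //; apply: cvgB; [exact: cvg_cst|exact: cvgM].
have c1' : P z.1 @[z --> (M, q)] --> P M by exact: (cvg_comp _ _ c1 (@cP _)).
have c3' : P (z.1 * (1 - z.2 ^+ 2)) @[z --> (M, q)] --> P (M * (1 - q ^+ 2)).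
  exact: (cvg_comp _ _ c3 (@cP _)).
exact: cvgB.
Qed.

Lemma slowness_continuous M q : 0 < M -> 0 < q -> slowness z.1 z.2 @[z --> (M, q)] --> slowness M q.
Proof.
move=> M0 q0; apply: cvgM.
  apply: cvgM; last exact: cvg_snd.
  by apply: cvgM; [exact: cvg_cst|exact: cvg_fst].
apply: cvgV; first by rewrite gt_eqF// sqrtr_gt0 energy_drop_gt0.
exact: (cvg_comp _ _ (@energy_drop_continuous M q) (@sqrt_continuous _ _)).
Qed.

Lemma slowness_continuous_l M q : 0 < M -> 0 <= q -> {for M, continuous (slowness ^~ q)}.
Proof.
move=> M0; rewrite le_eqVlt => /predU1P[<-|q0].
  by rewrite (_ : slowness ^~ 0 = cst 0); [exact: cvg_cst|apply/funext => ?; exact: slowness0].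
have Mq : (x, q) @[x --> M] --> (M, q).
  exact: (@cvg_pair _ _ _ (nbhs M) (nbhs M) (nbhs q) _ _ _ id (cst q) cvg_id (cvg_cst _)).
exact: (cvg_comp _ _ Mq (slowness_continuous M0 q0)).
Qed.

Lemma slowness_continuous_r M q : 0 < M -> 0 < q -> {for q, continuous (slowness M)}.
Proof.
move=> M0 q0.
have Mq : (M, x) @[x --> q] --> (M, q).
  exact: (@cvg_pair _ _ _ (nbhs q) (nbhs M) (nbhs q) _ _ _ (cst M) id (cvg_cst _) cvg_id).
exact: (cvg_comp _ _ Mq (slowness_continuous M0 q0)).
Qed.

Lemma measurable_slowness M : 0 < M -> measurable_fun (`[0, 1] : set R) (slowness M).
Proof.
move=> M0.
have H : measurable_fun (`]0, +oo[ : set R) (slowness M).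
  apply: open_continuous_measurable_fun; first exact: interval_open.
  by move=> q; rewrite inE/= in_itv/= andbT => q0; exact: slowness_continuous_r.
have H1 : measurable_fun (`]0, 1] : set R) (slowness M).
  by apply: measurable_funS H => //; exact: subset_itvl.
exact/measurable_fun_itv_obnd_cbndP.
Qed.

Lemma slowness_integrable M x y : 0 < M -> 0 <= x -> y <= 1 ->
  mu.-integrable `[x, y] (EFin \o slowness M).
Proof.
move=> M0 x0 y1.
have sub : ([set` `[x, y]] : set R) `<=` `[0, 1]%classic.
  by apply: subset_itv; rewrite bnd_simp.
apply: (@integrableS _ _ _ mu `[0, 1]%classic) => //.
apply: (@bounded_integrable _ _ _ _ (2 * Num.sqrt (M / m))); first exact: measurable_slowness.
move=> t; rewrite in_itv/= => /andP[t0 t1].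
by rewrite ger0_norm ?slowness_ge0// slowness_le.
Qed.

Lemma time_map0 M : time_map M 0 = 0.
Proof. by rewrite /time_map set_itv1 Rintegral_set1. Qed.

Lemma time_mapB M x y : 0 < M -> 0 <= x -> x <= y -> y <= 1 ->
  time_map M y - time_map M x = \int[mu]_(t in `[x, y]) slowness M t.
Proof.
move=> M0 x0 xy y1; rewrite /time_map (@Rintegral_chasles _ _ 0 x y)//.
  by rewrite addrC addKr.
exact: slowness_integrable.
Qed.

Lemma time_map_le M x y : 0 < M -> 0 <= x -> x <= y -> y <= 1 ->
  time_map M y - time_map M x <= 2 * Num.sqrt (M / m) * (y - x).
Proof.
move=> M0 x0 xy y1; rewrite time_mapB//; apply: Rintegral_le_bound => //.
  exact: slowness_integrable.
move=> t; rewrite in_itv/= => /andP[xt ty]; apply: slowness_le => //; lra.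
Qed.

Lemma time_map_ge M x y : 0 < M -> 0 <= x -> x <= y -> y <= 1 ->
  2 * Num.sqrt (M / B M) * (y - x) <= time_map M y - time_map M x.
Proof.
move=> M0 x0 xy y1; rewrite time_mapB//.
rewrite -(Rintegral_itv_obnd_cbnd (r := x)); last first.
  by apply: integrableS (slowness_integrable M0 x0 y1) => //; exact: subset_itv_oc_cc.
rewrite -(Rintegral_itv_cst (2 * Num.sqrt (M / B M)) xy).
rewrite -(Rintegral_itv_obnd_cbnd (r := x)); last first.
  apply: integrableS (continuous_integrable x y (@cst_continuous _ _ _)) => //.
  exact: subset_itv_oc_cc.
apply: le_Rintegral => //.
- apply: integrableS (continuous_integrable x y (@cst_continuous _ _ _)) => //.
  exact: subset_itv_oc_cc.
- by apply: integrableS (slowness_integrable M0 x0 y1) => //; exact: subset_itv_oc_cc.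
move=> t; rewrite /= in_itv/= => /andP[xt ty]; apply: slowness_ge => //; lra.
Qed.

(** Continuity under the integral sign: near [M] the integrands are dominated by
    a constant. *)
Lemma time_map1_continuous M : 0 < M -> {for M, continuous (time_map ^~ 1)}.
Proof.
move=> M0.
have := @continuity_under_integral R _ _ mu slowness `[0, 1]%classic (measurable_itv _) 0 (M + M).
move=> /(_ _ _ (cst (2 * Num.sqrt ((M + M) / m)))) H; apply: H.
- by move=> x /=; rewrite in_itv/= => /andP[x0 xM]; exact: slowness_integrable.
- apply: nearW => q /=; rewrite in_itv/= => /andP[q0 q1] x.
  by rewrite inE/= in_itv/= => /andP[x0 xM]; exact: slowness_continuous_l.
- by apply: continuous_integrable; exact: cst_continuous.
- move=> x /=; rewrite in_itv/= => /andP[x0 xM]; apply: nearW => q /=.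
  rewrite in_itv/= => /andP[q0 q1]; rewrite ger0_norm ?slowness_ge0//.
  apply: (le_trans (slowness_le _ _ _)) => //; rewrite ler_pM2l// ler_wsqrtr//.
  by rewrite ler_pM2r ?invr_gt0//; exact: ltW.
- by rewrite inE/= in_itv/=; apply/andP; split; lra.
Qed.

Lemma time_map_derive M q : 0 < M -> 0 < q -> q < 1 -> is_derive q 1 (time_map M) (slowness M q).
Proof.
move=> M0 q0 q1.
have [D1 D2] := continuous_FTC1_closed q1 (slowness_integrable M0 (lexx 0) (lexx 1)) q0
  (slowness_continuous_r M0 q0).
by apply: DeriveDef; rewrite -?derive1E.
Qed.

End time_map_theory.

(** * A value of the time map below the length of the interval *)

Section dip.
Context {R : realType}.

(** Cut [a, b] into [n] equal parts; the decrease over one part is at most a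
    constant times [n ^ (- 3 / 2)], so the total decrease tends to [0]. *)
Lemma le_of_superlinear_decrease (f : R -> R) (C a b : R) : 0 <= C -> a <= b ->
  (forall x y, a <= x -> x < y -> y <= b ->
     - (C * (y - x) * Num.sqrt (y - x)) <= f y - f x) ->
  f a <= f b.
Proof.
move=> C0; rewrite le_eqVlt => /predU1P[->//|ab] H.
rewrite leNgt; apply/negP => fba.
set e := f a - f b; have e0 : 0 < e by rewrite subr_gt0.
set l := b - a; have l0 : 0 < l by rewrite subr_gt0.
have key n : e <= C * l * Num.sqrt (l / n.+1%:R).
  set dl := l / n.+1%:R; have dl0 : 0 < dl by rewrite divr_gt0.
  have step i : (i <= n.+1)%N ->
      - (C * dl * Num.sqrt dl) *+ i <= f (a + dl *+ i) - f a.
    elim: i => [|i IH] ilen; first by rewrite !mulr0n addr0 subrr.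
    have {}IH := IH (ltnW ilen).
    have := H (a + dl *+ i) (a + dl *+ i.+1).
    have -> : a + dl *+ i.+1 - (a + dl *+ i) = dl by rewrite mulrSr; ring.
    have d1 : 0 <= dl *+ i by rewrite mulrn_wge0// ltW.
    have d2 : dl *+ i.+1 <= l.
      rewrite -mulr_natr /dl mulrAC ler_pdivrMr// ler_pM2l// ler_nat//.
    move=> /(_ _ _ _)-/(_ ltac:(lra)) H'.
    have {}H' : - (C * dl * Num.sqrt dl) <= f (a + dl *+ i.+1) - f (a + dl *+ i).
      apply: H'; last by rewrite /l in d2; lra.
      by rewrite mulrSr; lra.
    by rewrite mulrSr; lra.
  have := step n.+1 (leqnn _).
  have -> : a + dl *+ n.+1 = b.
    by rewrite -mulr_natr /dl divfK ?pnatr_eq0// /l; ring.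
  have -> : - (C * dl * Num.sqrt dl) *+ n.+1 = - (C * l * Num.sqrt dl).
    rewrite -mulr_natr /dl; move: (ltr0Sn R n); set N := n.+1%:R => N0.
    by field; rewrite gt_eqF.
  by rewrite /e; lra.
have [n] : exists n : nat, (C * l) ^+ 2 * l / e ^+ 2 < n%:R.
  exists (Num.bound ((C * l) ^+ 2 * l / e ^+ 2)); apply: archi_boundP.
  by rewrite divr_ge0 ?sqr_ge0// mulr_ge0 ?sqr_ge0// ltW.
rewrite ltr_pdivrMr ?exprn_gt0// => nlt.
have : e ^+ 2 <= (C * l) ^+ 2 * (l / n.+1%:R).
  have := key n; rewrite -(ler_pXn2r (n := 2)) ?nnegrE ?(ltW e0)//; last first.
    by rewrite !mulr_ge0 ?sqrtr_ge0// ltW.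
  by rewrite exprMn sqr_sqrtr// divr_ge0// ltW.
rewrite mulrA ler_pdivlMr// -natr1.
have := sqr_ge0 e; lra.
Qed.

Variables (P B : R -> R) (m : R).
Hypothesis hP : potential P B m.
Let m_gt0 : 0 < m. Proof. by case: hP. Qed.
Let cP : continuous P. Proof. by case: hP. Qed.
Let P_ge x y : 0 <= x -> x <= y -> m * (y - x) <= P y - P x.
Proof. by case: hP => _ _ _ + _; exact. Qed.
Let P_le K x y : 0 <= x -> x <= y -> y <= K -> P y - P x <= B K * (y - x).
Proof. by case: hP => _ _ _ _; exact. Qed.
Implicit Types (M h L x y : R).

Lemma potential_le x y : 0 <= x -> x <= y -> P x <= P y.
Proof.
move=> x0 xy; rewrite -subr_ge0; apply: le_trans (P_ge x0 xy).
by rewrite mulr_ge0 ?(ltW m_gt0)// subr_ge0.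
Qed.

Lemma potential_lt x y : 0 <= x -> x < y -> P x < P y.
Proof.
move=> x0 xy; rewrite -subr_gt0; apply: lt_le_trans (P_ge x0 (ltW xy)).
by rewrite mulr_gt0 ?m_gt0// subr_gt0.
Qed.

(** The speed at height [r] on the trajectory with energy [h]. *)
Let speed h r := Num.sqrt (h - P r).

Lemma speed_continuous h : continuous (speed h).
Proof.
move=> r; have c : (h - P x) @[x --> r] --> h - P r.
  by apply: cvgB; [exact: cvg_cst|exact: (@cP r)].
exact: (cvg_comp _ _ c (@sqrt_continuous _ _)).
Qed.

(** Lower bound, dual in [h], for half the integral of [u' ^ 2 - P u] over an interval
    of length [L], among the functions that climb from [0] to [M]. *)
Let action L h M := \int[mu]_(r in `[0, M]) speed h r - h * L / 2.

Lemma action_le L h M1 M2 : 0 <= M1 -> M1 <= M2 -> action L h M1 <= action L h M2.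
Proof.
move=> M10 M12; rewrite /action lerD2r (@Rintegral_chasles _ _ 0 M1 M2)//; last first.
  exact/continuous_integrable/speed_continuous.
by rewrite lerDl; apply: Rintegral_ge0 => r _; exact: sqrtr_ge0.
Qed.

(** For this energy the speed is at least [c / L] at all heights up to [c]. *)
Lemma action_gt0 L c : 0 < L -> 0 < c -> P c < (c / L) ^+ 2 ->
  0 < action L (P c + (c / L) ^+ 2) c.
Proof.
move=> L0 c0 Pc; have cL : 0 < c / L by exact: divr_gt0.
have /(_ (c / L)) H := @Rintegral_ge_bound _ (speed (P c + (c / L) ^+ 2)) 0 c _ (ltW c0)
  (continuous_integrable _ _ (@speed_continuous _)).
rewrite /action subr_gt0; apply: (lt_le_trans _ (H _)); last first.
  move=> t; rewrite in_itv/= => /andP[t0 tc].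
  rewrite -[leLHS]gtr0_norm// -sqrtr_sqr ler_wsqrtr//.
  by have := potential_le t0 tc; lra.
rewrite subr0; have -> : c / L * c = (c / L) ^+ 2 * L.
  by field; rewrite gt_eqF.
have : P c * L < (c / L) ^+ 2 * L by rewrite ltr_pM2r.
by move: ((c / L) ^+ 2) => X; lra.
Qed.

(** Bound the speed [s] by [(s ^ 2 / q + q) / 2] with [q = 2 d / L], the slope of the
    function that climbs linearly to the height [d] in the first half of the
    interval. *)
Lemma action_lt0 L d h : 0 < L -> 0 < d -> 4 * (d / L) ^+ 2 < P d -> P d <= h ->
  action L h d < 0.
Proof.
move=> L0 d0 Pd hd; have dL : 0 < d / L by exact: divr_gt0.
set q := 2 * (d / L); have q0 : 0 < q by rewrite mulr_gt0.
have q4 : q ^+ 2 = 4 * (d / L) ^+ 2 by rewrite /q; ring.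
have /(_ (h / (2 * q) + q / 2)) H := @Rintegral_le_bound _ (speed h) 0 d _ (ltW d0)
  (continuous_integrable _ _ (@speed_continuous _)).
rewrite /action subr_lt0; apply: (le_lt_trans (H _)).
  move=> t; rewrite in_itv/= => /andP[t0 td].
  have P0 : P 0 = 0 by exact: potential0 hP.
  have Pt : 0 <= P t by rewrite -P0 potential_le.
  have ht : 0 <= h - P t by have := potential_le t0 td; lra.
  rewrite (_ : _ + _ = (h + q ^+ 2) / (2 * q)); last by field; rewrite gt_eqF.
  have qq : 0 < 2 * q by exact: mulr_gt0.
  rewrite ler_pdivlMr//.
  have := sqr_ge0 (speed h t - q); rewrite sqrrB sqr_sqrtr//; lra.
have -> : (h / (2 * q) + q / 2) * (d - 0) = h * L / 4 + q ^+ 2 * L / 4.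
  by rewrite /q; field; rewrite !gt_eqF.
have hq : q ^+ 2 * L < h * L by rewrite ltr_pM2r//; lra.
lra.
Qed.

(** The substitution [r = M2 (1 - q ^ 2)], away from the singular height [M2]. *)
Lemma inv_speed_integral M1 M2 : 0 < M1 -> M1 < M2 ->
  \int[mu]_(r in `[0, M1]) (speed (P M2) r)^-1 =
  time_map P M2 1 - time_map P M2 (Num.sqrt (1 - M1 / M2)).
Proof.
move=> M10 M12; have M20 : 0 < M2 by exact: lt_trans M12.
have M1d : 0 < M1 / M2 < 1 by rewrite divr_gt0//= ltr_pdivrMr// mul1r.
set q := Num.sqrt _.
have q2 : q ^+ 2 = 1 - M1 / M2 by rewrite sqr_sqrtr//; lra.
have q0 : 0 < q by rewrite sqrtr_gt0; lra.
have q1 : q < 1 by rewrite -(ltr_pXn2r (n := 2)) ?nnegrE ?(ltW q0)// q2 expr1n; lra.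
rewrite (time_mapB hP)//; [|exact: ltW..].
pose F (t : R) : R := M2 * (1 - t ^+ 2).
have isdF (t : R) : is_derive t 1 F (- (2 * M2 * t)).
  apply/is_derive1_caratheodory; exists (fun z => - M2 * (z + t)); split.
  - by move=> z; rewrite /F; ring.
  - by apply: cvgM; [exact: cvg_cst|apply: cvgD; [exact: cvg_id|exact: cvg_cst]].
  - by ring.
have dF : derive1 F = (fun t => - (2 * M2 * t)).
  by apply/funext => t; rewrite derive1E; exact: derive_val.
have F1 : F 1 = 0 by rewrite /F expr1n subrr mulr0.
have Fq : F q = M1 by rewrite /F q2; field; rewrite gt_eqF.
have cdF : continuous (derive1 F).
  rewrite dF => t; apply: cvgN; apply: cvgM; [exact: cvg_cst|exact: cvg_id].
have derF (t : R) : derivable F t 1 by have [] := isdF t.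
have cF : continuous F.
  by move=> t; apply/differentiable_continuous; rewrite -derivable1_diffP.
rewrite /Rintegral -{1}F1 -{1}Fq.
rewrite (@integration_by_substitution_decreasing _ F (fun r => (speed (P M2) r)^-1) q 1)//.
- congr fine; apply: eq_integral => t; rewrite inE/= in_itv/= => /andP[qt t1]; congr (_%:E).
  by rewrite dF /slowness /speed /energy_drop /F /= opprK mulrC.
- exact: ltW.
- move=> x y; rewrite !in_itv/= => /andP[qx x1] /andP[qy y1] xy.
  rewrite /F ltr_pM2l// ltrD2l ltrN2 ltr_pXn2r// nnegrE; lra.
- by apply/cvg_ex; exists (derive1 F q); apply: cvg_at_right_filter; exact: (@cdF q).
- by apply/cvg_ex; exists (derive1 F 1); apply: cvg_at_left_filter; exact: (@cdF 1).
- split.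
  + by move=> t _; exact: derF.
  + by apply: cvg_at_right_filter; exact: (@cF q).
  + by apply: cvg_at_left_filter; exact: (@cF 1).
- rewrite F1 Fq; apply: continuous_in_subspaceT.
  move=> r; rewrite inE/= in_itv/= => /andP[r0 rM].
  apply: cvgV; last exact: speed_continuous.
  by rewrite gt_eqF// sqrtr_gt0 subr_gt0; apply: potential_lt => //; lra.
Qed.

(** The action increases with [M], and with respect to [h] it is concave: since
    [sqrt A - sqrt A' >= (A - A') / (2 sqrt A)], its increment is controlled by the time
    that the trajectory of amplitude [M2] needs to reach the height [M1]. The last
    correction bounds the time from [M1] to [M2]. *)
Lemma action_increment L M1 M2 : 0 < L -> 0 < M1 -> M1 < M2 ->
  (P M2 - P M1) / 2 * (time_map P M2 1 - L - 2 * Num.sqrt ((M2 - M1) / m)) <=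
  action L (P M2) M2 - action L (P M1) M1.
Proof.
move=> L0 M10 M12; have M20 : 0 < M2 by exact: lt_trans M12.
have P12 : P M1 < P M2 by apply: potential_lt => //; exact: ltW.
have H1 : action L (P M2) M1 <= action L (P M2) M2 by apply: action_le; exact: ltW.
have iq c : mu.-integrable `[0, M1] (EFin \o (fun r => c * (speed (P M2) r)^-1)).
  apply: continuous_compact_integrable; first exact: segment_compact.
  apply/continuous_in_subspaceT => r; rewrite inE/= in_itv/= => /andP[r0 rM].
  apply: cvgM; [exact: cvg_cst|apply: cvgV]; last exact: speed_continuous.
  by rewrite gt_eqF// sqrtr_gt0 subr_gt0; apply: potential_lt => //; lra.
have H2 : (P M2 - P M1) / 2 * \int[mu]_(r in `[0, M1]) (speed (P M2) r)^-1 <=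
    \int[mu]_(r in `[0, M1]) speed (P M2) r - \int[mu]_(r in `[0, M1]) speed (P M1) r.
  rewrite -RintegralZl//; last first.
    by apply: eq_integrable (iq 1) => // r _; rewrite /= mul1r.
  rewrite -RintegralB//; [|exact/continuous_integrable/speed_continuous..].
  apply: le_Rintegral => //.
    by apply: continuous_integrable => r; apply: cvgB; exact: speed_continuous.
  move=> r; rewrite /= in_itv/= => /andP[r0 rM].
  have Pr1 : P r <= P M1 by exact: potential_le.
  have s2 : 0 < speed (P M2) r by rewrite sqrtr_gt0; lra.
  have s1 : 0 <= speed (P M1) r by exact: sqrtr_ge0.
  have s12 : speed (P M1) r <= speed (P M2) r by apply: ler_wsqrtr; lra.
  have -> : P M2 - P M1 = speed (P M2) r ^+ 2 - speed (P M1) r ^+ 2.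
    by rewrite !sqr_sqrtr; lra.
  rewrite ler_pdivrMr//; have := sqr_ge0 (speed (P M2) r - speed (P M1) r); lra.
have q0 : 0 <= 1 - M1 / M2 by rewrite subr_ge0 ler_pdivrMr// mul1r ltW.
have q1 : Num.sqrt (1 - M1 / M2) <= 1.
  rewrite -[leRHS]sqrtr1 ler_wsqrtr// lerBlDr lerDl divr_ge0//; exact: ltW.
have := time_map_le hP M20 (lexx 0) (sqrtr_ge0 _) q1.
rewrite time_map0 !subr0 -mulrA -sqrtrM; last by rewrite divr_ge0// ltW.
have -> : M2 / m * (1 - M1 / M2) = (M2 - M1) / m by field; rewrite !gt_eqF.
move=> H3.
move: H2; rewrite inv_speed_integral// => H2.
have H4 : (P M2 - P M1) / 2 * (time_map P M2 1 - L - 2 * Num.sqrt ((M2 - M1) / m)) <=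
  (P M2 - P M1) / 2 * (time_map P M2 1 - time_map P M2 (Num.sqrt (1 - M1 / M2)) - L).
  by rewrite ler_pM2l ?divr_gt0 ?subr_gt0//; lra.
apply: (le_trans H4); rewrite mulrBr; move: H1 H2; rewrite /action; lra.
Qed.

(** If the time map were at least [L] on [c, d], then by [action_increment] the
    decrease of [action L (P M) M] between two heights would be at most a constant
    times the power [3 / 2] of their distance, so it would be nondecreasing. It
    starts positive: the energy [h0] of [action_gt0] is the potential of some
    height [M0], unless it is at least [P d], which [action_lt0] excludes at
    once. It ends negative at [d]. *)
Lemma time_map_dip L c d : 0 < L -> 0 < c -> c < d ->
  P c < (c / L) ^+ 2 -> 4 * (d / L) ^+ 2 < P d ->
  exists2 M, c <= M <= d & time_map P M 1 < L.
Proof.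
move=> L0 c0 cd Pc Pd; have d0 : 0 < d by exact: lt_trans cd.
apply: contrapT => /forall2NP T.
have {}T M : c <= M -> M <= d -> L <= time_map P M 1.
  by move=> cM Md; have [/negP|/negP] := T M; rewrite ?cM ?Md// -leNgt.
have A0 := action_gt0 L0 c0 Pc.
set h0 := P c + (c / L) ^+ 2 in A0.
have h0d : h0 < P d.
  rewrite ltNge; apply/negP => h0d; have := action_lt0 L0 d0 Pd h0d.
  by rewrite ltNge (le_trans (ltW A0))// action_le ?ltW.
have Pch : P c < h0 by rewrite ltrDl exprn_gt0// divr_gt0.
have [] := @IVT _ P c d h0 (ltW cd).
- exact: continuous_subspaceT.
- by rewrite ge_min le_max (ltW Pch) (ltW h0d) !orbT.
move=> M0; rewrite in_itv/= => /andP[cM0 M0d] PM0.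
have M00 : 0 < M0 by exact: lt_le_trans cM0.
have : action L (P M0) M0 <= action L (P d) d.
  have Bd : 0 <= B d by apply: le_trans (upper_slope_ge hP d0); exact: ltW.
  apply: (@le_of_superlinear_decrease (fun M => action L (P M) M)
    (B d / Num.sqrt m) M0 d) => //.
    by rewrite divr_ge0// sqrtr_ge0.
  move=> x y M0x xy yd.
  have x0 : 0 < x by exact: lt_le_trans M0x.
  apply: le_trans (action_increment L0 x0 xy).
  have Txy : 0 <= time_map P y 1 - L by rewrite subr_ge0 T//; lra.
  have Pxy : 0 < P y - P x by rewrite subr_gt0 potential_lt// ltW.
  have PBxy : P y - P x <= B d * (y - x) by apply: P_le; lra.
  rewrite sqrtrM; last lra.
  have -> : Num.sqrt m^-1 = (Num.sqrt m)^-1 by rewrite sqrtrV// ltW.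
  set s := Num.sqrt (y - x); set k := (Num.sqrt m)^-1.
  have sk : 0 <= s * k by rewrite mulr_ge0 ?invr_ge0 ?sqrtr_ge0.
  have H1 : (P y - P x) * (s * k) <= B d * (y - x) * (s * k) by exact: ler_wpM2r.
  have H2 : 0 <= (P y - P x) / 2 * (time_map P y 1 - L) by rewrite mulr_ge0// divr_ge0// ltW.
  rewrite mulrBr; lra.
rewrite PM0 => Ah; have := action_lt0 L0 d0 Pd (lexx _); rewrite ltNge.
rewrite (le_trans (ltW A0))// (le_trans _ Ah)// action_le// ltW//.
Qed.

(** The speed never exceeds [sqrt (P M)], its value at height [0]. *)
Lemma time_map1_ge M : 0 < M -> M / Num.sqrt (P M) <= time_map P M 1.
Proof.
move=> M0; have P0 := potential0 hP.
have PM : 0 < P M by rewrite -P0 potential_lt.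
have isq (q : R) : is_derive q 1 (fun q : R => q ^+ 2) (2 * q).
  apply/is_derive1_caratheodory; exists (fun z => z + q); split.
  - by move=> z; ring.
  - by apply: cvgD; [exact: cvg_id|exact: cvg_cst].
  - by ring.
have dq : {in `]0, 1[, derive1 (fun q : R => q ^+ 2) =1 (fun q => 2 * q)}.
  by move=> q _; rewrite derive1E; exact: derive_val.
have i2 : \int[mu]_(q in `[0, 1]) (2 * q) = 1 :> R.
  rewrite /Rintegral (@continuous_FTC2 _ _ (fun q => q ^+ 2))//.
  - by rewrite expr1n expr0n/= subr0.
  - by apply: continuous_subspaceT => q; apply: cvgM; [exact: cvg_cst|exact: cvg_id].
  - split.
    + by move=> q _; have [] := isq q.
    + by apply: cvg_at_right_filter; exact: exprn_continuous.
    + by apply: cvg_at_left_filter; exact: exprn_continuous.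
have cq : mu.-integrable `[0, 1] (EFin \o (fun q : R => 2 * q)).
  by apply: continuous_integrable => q; apply: cvgM; [exact: cvg_cst|exact: cvg_id].
have -> : M / Num.sqrt (P M) = \int[mu]_(q in `[0, 1]) (M / Num.sqrt (P M) * (2 * q)).
  by rewrite RintegralZl// i2 mulr1.
apply: le_Rintegral => //.
- by apply: continuous_integrable => q; do 2 (apply: cvgM; first exact: cvg_cst); exact: cvg_id.
- exact: (slowness_integrable hP).
move=> q; rewrite /= in_itv/= => /andP[]; rewrite le_eqVlt => /predU1P[<- _|q0 q1].
  by rewrite !mulr0 slowness0.
have D0 := energy_drop_gt0 hP M0 q0.
rewrite /slowness [leRHS](_ : _ = M / Num.sqrt (energy_drop P M q) * (2 * q)); last by ring.
rewrite ler_pM2r ?mulr_gt0// ler_pM2l// lef_pV2 ?posrE ?sqrtr_gt0// ler_wsqrtr//.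
rewrite /energy_drop gerBl -P0 potential_le// mulr_ge0//; first exact: ltW.
by rewrite subr_ge0 expr_le1// ltW.
Qed.

End dip.

(** * Three amplitudes *)

Section amplitudes.
Context {R : realType}.
Variables (P B : R -> R) (m : R).
Hypothesis hP : potential P B m.
Let m_gt0 : 0 < m. Proof. by case: hP. Qed.

Lemma time_map_level x y L : 0 < x -> x <= y ->
  (time_map P x 1 < L < time_map P y 1) || (time_map P y 1 < L < time_map P x 1) ->
  exists2 M, x < M < y & time_map P M 1 = L.
Proof.
move=> x0 xy TL; have [] := @IVT _ (time_map P ^~ 1) x y L xy.
- apply: continuous_in_subspaceT => M; rewrite inE/= in_itv/= => /andP[xM _].
  by apply: (time_map1_continuous hP); exact: lt_le_trans xM.
- by case/orP: TL => /andP[/ltW T1 /ltW T2]; rewrite ge_min le_max T1 T2 ?orbT.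
move=> M; rewrite in_itv/= => /andP[xM My] TM; exists M => //.
rewrite !lt_neqAle xM My !andbT; apply/andP; split; apply/eqP => E; move: TL.
  by rewrite E TM !ltxx/= andbF.
by rewrite -E TM !ltxx/= andbF.
Qed.

Lemma three_amplitudes L c d : 0 < L -> 0 < c -> c < d ->
  P c < (c / L) ^+ 2 -> 4 * (d / L) ^+ 2 < P d ->
  (forall C, exists2 M, d <= M & C * B M <= M) ->
  exists M : 'I_3 -> R, [/\ forall i, 0 < M i, forall i, time_map P (M i) 1 = L &
    forall i j, i != j -> M i != M j].
Proof.
move=> L0 c0 cd Pc Pd hB; have d0 : 0 < d by exact: lt_trans cd.
have Tc : L < time_map P c 1.
  apply: lt_le_trans (time_map1_ge hP c0).
  have Pc0 : 0 < P c by rewrite -(potential0 hP); apply: (potential_lt hP).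
  rewrite ltr_pdivlMr ?sqrtr_gt0// mulrC -ltr_pdivlMr//.
  by rewrite -[ltRHS]gtr0_norm ?divr_gt0// -sqrtr_sqr ltr_sqrt// exprn_gt0// divr_gt0.
have [Md /andP[cMd Mdd] TMd] := time_map_dip hP L0 c0 cd Pc Pd.
(* The time map is at most 2 sqrt (M / m), which is below L for M < m L^2 / 4. *)
pose Ms := Num.min (c / 2) (m * L ^+ 2 / 8).
have mL : 0 < m * L ^+ 2 by rewrite mulr_gt0// exprn_gt0.
have Ms0 : 0 < Ms by rewrite lt_min !divr_gt0.
have Msc : Ms < c by rewrite gt_min; apply/orP; left; lra.
have TMs : time_map P Ms 1 < L.
  have := time_map_le hP Ms0 (lexx 0) ler01 (lexx 1).
  rewrite time_map0 !subr0 mulr1 => /le_lt_trans; apply.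
  have : Num.sqrt (Ms / m) < Num.sqrt ((L / 2) ^+ 2).
    rewrite ltr_sqrt ?exprn_gt0 ?divr_gt0// ltr_pdivrMr//.
    have : Ms <= m * L ^+ 2 / 8 by rewrite ge_min lexx orbT.
    have -> : (L / 2) ^+ 2 * m = m * L ^+ 2 / 4 by field.
    move: mL; set X := m * _; lra.
  by rewrite sqrtr_sqr gtr0_norm ?divr_gt0//; lra.
(* The time map is at least 2 sqrt (M / B M), which is at least 2 L
   once L^2 B M <= M. *)
have [Ml dMl BMl] := hB (L ^+ 2).
have Ml0 : 0 < Ml by exact: lt_le_trans dMl.
have BMl0 : 0 < B Ml by exact: lt_le_trans (upper_slope_ge hP Ml0).
have TMl : L < time_map P Ml 1.
  have := time_map_ge hP Ml0 (lexx 0) ler01 (lexx 1).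
  rewrite time_map0 !subr0 mulr1; apply: lt_le_trans.
  have : Num.sqrt (L ^+ 2) <= Num.sqrt (Ml / B Ml) by rewrite ler_wsqrtr// ler_pdivlMr.
  by rewrite sqrtr_sqr gtr0_norm//; lra.
have [M0 /andP[sM0 M0c] TM0] : exists2 M, Ms < M < c & time_map P M 1 = L.
  by apply: time_map_level => //; [exact: ltW|rewrite TMs Tc].
have [M1 /andP[cM1 M1d] TM1] : exists2 M, c < M < Md & time_map P M 1 = L.
  by apply: time_map_level => //; rewrite TMd Tc orbT.
have [M2 /andP[dM2 _] TM2] : exists2 M, Md < M < Ml & time_map P M 1 = L.
  by apply: time_map_level => //; [lra|lra|rewrite TMd TMl].
exists (fun i : 'I_3 => nth 0 [:: M0; M1; M2] i).
have l01 : M0 < M1 by exact: lt_trans cM1.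
have l12 : M1 < M2 by exact: lt_trans dM2.
have l02 : M0 < M2 by exact: lt_trans l12.
have M00 : 0 < M0 by exact: lt_trans sM0.
split.
- by move=> [[|[|[|]]]]//= _; [exact: lt_trans l01|exact: lt_trans l02].
- by move=> [[|[|[|]]]].
- by move=> [[|[|[|]]]]//= ? [[|[|[|]]]]//= ? _;
    rewrite ?(lt_eqF l01) ?(lt_eqF l12) ?(lt_eqF l02) ?(gt_eqF l01) ?(gt_eqF l12) ?(gt_eqF l02).
Qed.

End amplitudes.

(** * The solution with a given amplitude *)

Section solution.
Context {R : realType}.
Variables (P B : R -> R) (m : R).
Hypothesis hP : potential P B m.
Let m_gt0 : 0 < m. Proof. by case: hP. Qed.
Let P_le K x y : 0 <= x -> x <= y -> y <= K -> P y - P x <= B K * (y - x).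
Proof. by case: hP => _ _ _ _; exact. Qed.

(** The inverse of the time map is extended by constants outside [0, L]. *)
Let clamp (L t : R) : R := Num.max 0 (Num.min t L).

Lemma clamp_itv L t : 0 <= L -> 0 <= clamp L t <= L.
Proof. by move=> L0; rewrite le_max lexx/= ge_max L0 ge_min lexx orbT. Qed.

Lemma clamp_id L t : 0 <= t -> t <= L -> clamp L t = t.
Proof. by move=> t0 tL; rewrite /clamp min_l// max_r. Qed.

Lemma clamp_lipschitz L s t : 0 <= L -> `|clamp L s - clamp L t| <= `|s - t|.
Proof.
move=> L0; rewrite /clamp /Num.max /Num.min.
have := normr_ge0 (s - t); have := ler_norm (s - t).
have := ler_norm (t - s); rewrite distrC; move: `|s - t| => n.
move=> ? ? ?; case: (ltP s L) => ?; case: (ltP t L) => ?; do 2? case: (ltP 0 _) => ?;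
  by rewrite ler_norml; apply/andP; split; lra.
Qed.

(** A square root of a Lipschitz function need not be Lipschitz; here the difference
    of the energy drops at [p >= q] is at most a constant times [p (p - q)], and the
    factor [p] is absorbed by the square root at [p]. *)
Lemma sqrt_energy_drop_lipschitz M p q : 0 < M -> 0 <= p <= 1 -> 0 <= q <= 1 ->
  `|Num.sqrt (energy_drop P M p) - Num.sqrt (energy_drop P M q)| <=
  2 * B M * M / Num.sqrt (m * M) * `|p - q|.
Proof.
move=> M0; wlog qp : p q / q <= p.
  move=> H p01 q01; have [qp|/ltW pq] := leP q p; first exact: H.
  by rewrite distrC [`|p - q|]distrC; exact: H.
move=> /andP[p0 p1] /andP[q0 q1].
move: p0; rewrite le_eqVlt => /predU1P[p0|p0].
  have -> : q = p by apply/eqP; rewrite eq_le qp -p0 q0.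
  by rewrite !subrr !normr0 mulr0.
have qp2 : q ^+ 2 <= p ^+ 2 by rewrite ler_pXn2r// nnegrE ltW.
have p21 : p ^+ 2 <= 1 by rewrite expr_le1// ltW.
have D : energy_drop P M p - energy_drop P M q <= B M * (M * (p ^+ 2 - q ^+ 2)).
  have -> : energy_drop P M p - energy_drop P M q = P (M * (1 - q ^+ 2)) - P (M * (1 - p ^+ 2)).
    by rewrite /energy_drop; ring.
  have -> : M * (p ^+ 2 - q ^+ 2) = M * (1 - q ^+ 2) - M * (1 - p ^+ 2) by ring.
  apply: P_le; first by rewrite mulr_ge0 ?subr_ge0// ltW.
    by rewrite ler_pM2l//; lra.
  by rewrite -[leRHS]mulr1 ler_pM2l//; have := sqr_ge0 q; lra.
have Dqp : energy_drop P M q <= energy_drop P M p.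
  rewrite /energy_drop lerD2l lerN2; apply: (potential_le hP).
    by rewrite mulr_ge0 ?subr_ge0// ltW.
  by rewrite ler_pM2l//; lra.
have mM0 : 0 < m * M by exact: mulr_gt0.
have sp : Num.sqrt (m * M) * p <= Num.sqrt (energy_drop P M p).
  rewrite -[X in _ * X <= _]gtr0_norm// -sqrtr_sqr -sqrtrM; last exact: ltW.
  by apply: ler_wsqrtr; apply: (energy_drop_ge hP) => //; exact: ltW.
have S0 : 0 < Num.sqrt (m * M) by rewrite sqrtr_gt0.
have B0 : 0 < B M by apply: lt_le_trans (upper_slope_ge hP M0).
have Dq0 : 0 <= energy_drop P M q.
  by apply: le_trans (energy_drop_ge hP M0 q0 q1); rewrite mulr_ge0 ?sqr_ge0// ltW.
have X2 := sqr_sqrtr (le_trans Dq0 Dqp); have Y2 := sqr_sqrtr Dq0.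
have Y0 : 0 <= Num.sqrt (energy_drop P M q) by exact: sqrtr_ge0.
have YX : Num.sqrt (energy_drop P M q) <= Num.sqrt (energy_drop P M p) by exact: ler_wsqrtr.
rewrite !ger0_norm ?subr_ge0//.
have {}D : Num.sqrt (energy_drop P M p) ^+ 2 - Num.sqrt (energy_drop P M q) ^+ 2 <=
    B M * (M * (p ^+ 2 - q ^+ 2)) by rewrite X2 Y2.
move: D; move: sp S0 Y0 YX.
move: (Num.sqrt (energy_drop P M p)) (Num.sqrt (energy_drop P M q)) (Num.sqrt (m * M)) => X Y S.
move=> sp S0 Y0 YX D.
rewrite [leRHS]mulrAC ler_pdivlMr// -(ler_pM2r p0).
have H1 : (X - Y) * (S * p) <= (X - Y) * X by rewrite ler_wpM2l ?subr_ge0.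
have H2 : 0 <= (X - Y) * Y by rewrite mulr_ge0 ?subr_ge0.
have H3 : 0 <= B M * M * ((p - q) * (p - q)) by rewrite !mulr_ge0 ?subr_ge0// ltW.
by lra.
Qed.

Let kmin M := 2 * Num.sqrt (M / B M).
Let kmax M := 2 * Num.sqrt (M / m).

Lemma time_map_bilipschitz M x y : 0 < M -> 0 <= x <= 1 -> 0 <= y <= 1 ->
  kmin M * `|x - y| <= `|time_map P M x - time_map P M y| <= kmax M * `|x - y|.
Proof.
move=> M0; wlog xy : x y / x <= y.
  move=> H x01 y01; have [xy|/ltW yx] := leP x y; first exact: H.
  by rewrite distrC [`|_ - time_map P M y|]distrC; exact: H.
move=> /andP[x0 x1] /andP[y0 y1].
have k0 : 0 <= kmin M * (y - x) by rewrite !mulr_ge0 ?sqrtr_ge0 ?subr_ge0.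
have T := time_map_ge hP M0 x0 xy y1.
rewrite distrC [`|_ - time_map P M y|]distrC !ger0_norm ?subr_ge0//.
  by rewrite T (time_map_le hP).
by rewrite -subr_ge0 (le_trans k0).
Qed.

(** The time map is bi-Lipschitz in [q], hence a homeomorphism from [0, 1] onto
    [0, L] with bi-Lipschitz inverse [Q]. *)
Lemma time_map_inverse M L : 0 < M -> 0 < L -> time_map P M 1 = L ->
  exists Q : R -> R, [/\ forall t, 0 <= Q t <= 1,
    forall t, time_map P M (Q t) = clamp L t,
    forall s t, kmin M * `|Q s - Q t| <= `|s - t|,
    forall s t, 0 <= s <= L -> 0 <= t <= L -> `|s - t| <= kmax M * `|Q s - Q t| &
    forall t, 0 < t < L -> 0 < Q t < 1 /\ is_derive t 1 Q (slowness P M (Q t))^-1].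
Proof.
move=> M0 L0 TL.
have lipT x y : 0 <= x <= 1 -> 0 <= y <= 1 -> _ := @time_map_bilipschitz M x y M0.
have kmin0 : 0 < kmin M.
  by rewrite mulr_gt0// sqrtr_gt0 divr_gt0//; exact: lt_le_trans (upper_slope_ge hP M0).
have cT : {within `[0, 1], continuous (time_map P M)}.
  rewrite /time_map; apply: parameterized_integral_continuous => //.
  exact: (slowness_integrable hP).
have ex t : exists q, 0 <= q <= 1 /\ time_map P M q = clamp L t.
  have [|q] := @IVT _ (time_map P M) 0 1 (clamp L t) ler01 cT.
    rewrite time_map0 TL; have /andP[c0 cL] := clamp_itv t (ltW L0).
    by move: (clamp L t) c0 cL => v c0 cL; rewrite ge_min le_max c0 cL orbT.
  by rewrite in_itv/= => q01 Tq; exists q.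
have [Q QE] := choice ex.
have Q01 t : 0 <= Q t <= 1 by have [] := QE t.
have TQ t : time_map P M (Q t) = clamp L t by have [] := QE t.
have T_inj x y : 0 <= x <= 1 -> 0 <= y <= 1 -> time_map P M x = time_map P M y -> x = y.
  move=> x01 y01 E; have /andP[+ _] := lipT x y x01 y01.
  rewrite E subrr normr0 pmulr_rle0// normr_le0 subr_eq0; exact: eqP.
have QT q : 0 <= q <= 1 -> Q (time_map P M q) = q.
  move=> q01; apply: T_inj => //; rewrite TQ clamp_id//.
    have := time_map_ge hP M0 (lexx 0) (proj1 (andP q01)) (proj2 (andP q01)).
    rewrite time_map0 !subr0; move/(le_trans _); apply.
    by rewrite mulr_ge0 ?(ltW kmin0)//; case/andP: q01.
  have := time_map_ge hP M0 (proj1 (andP q01)) (proj2 (andP q01)) (lexx 1).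
  rewrite TL -[_ <= L]subr_ge0; move/(le_trans _); apply.
  by rewrite mulr_ge0 ?(ltW kmin0)// subr_ge0; case/andP: q01.
exists Q; split => //.
- move=> s t; have /andP[+ _] := lipT _ _ (Q01 s) (Q01 t).
  by move/le_trans; apply; rewrite !TQ clamp_lipschitz// ltW.
- move=> s t /andP[s0 sL] /andP[t0 tL]; have /andP[_] := lipT _ _ (Q01 s) (Q01 t).
  by rewrite !TQ !clamp_id.
move=> t /andP[t0 tL].
have TQt : time_map P M (Q t) = t by rewrite TQ clamp_id// ltW.
have Qt01 : 0 < Q t < 1.
  have /andP[Q0 Q1] := Q01 t; rewrite !lt_neqAle Q0 Q1 !andbT.
  apply/andP; split; apply/eqP => E; move: TQt.
    by rewrite -E time_map0 => E'; rewrite -E' ltxx in t0.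
  by rewrite E TL => E'; rewrite E' ltxx in tL.
split => //; rewrite -[X in is_derive X]TQt.
have /andP[Q0 Q1] := Qt01.
have nearQ : \forall q \near Q t, q \in `]0, 1[ by apply: near_in_itvoo; rewrite in_itv.
apply: (@is_derive_inverse _ (time_map P M)).
- by apply: filterS nearQ => q; rewrite in_itv/= => /andP[q0 q1]; rewrite QT// !ltW.
- apply: filterS nearQ => q; rewrite in_itv/= => /andP[q0 q1].
  apply/differentiable_continuous; rewrite -derivable1_diffP.
  by have [] := time_map_derive hP M0 q0 q1.
- exact: (time_map_derive hP).
- by rewrite gt_eqF//; apply: (slowness_gt0 hP).
Qed.

(** With [q x = Q (b - x)] the solution is [u = M (1 - q ^ 2)] and its derivative is
    [w = sqrt (P M - P u)]. Outside the preimage of [E], the chain rule gives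
    [w' = - 2 rho u w / (2 w) = - rho u]. *)
Lemma solution_of_amplitude (a b M : R) (E : set R) (rho : R -> R) :
  a < b -> 0 < M -> time_map P M 1 = b - a ->
  measurable E -> mu E = 0%E -> measurable_fun [set: R] rho ->
  (forall y, 0 < y -> ~ E y -> is_derive y 1 P (2 * rho y)) ->
  exists u w : R -> R, [/\ [/\ continuous u, continuous w, u a = 0, u b = M &
      forall x, 0 <= u x <= M],
    forall x, x \in `]a, b[ -> is_derive x 1 u (w x),
    mu (`]a, b[ `&` u @^-1` E) = 0%E &
    forall x, x \in `[a, b] -> \int[mu]_(t in `[x, b]) rho (u t) = w x].
Proof.
move=> ab M0 TL mE E0 mrho dP; have L0 : 0 < b - a by rewrite subr_gt0.
have [Q [Q01 TQ Qlip Qexp Qder]] := time_map_inverse M0 L0 TL.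
have kmin0 : 0 < kmin M.
  by rewrite mulr_gt0// sqrtr_gt0 divr_gt0//; exact: lt_le_trans (upper_slope_ge hP M0).
have kmax0 : 0 < kmax M by rewrite mulr_gt0// sqrtr_gt0 divr_gt0.
have Q_eq t q : 0 <= q <= 1 -> time_map P M q = clamp (b - a) t -> Q t = q.
  move=> q01 Tq; have /andP[+ _] := time_map_bilipschitz M0 (Q01 t) q01.
  by rewrite TQ Tq subrr normr0 pmulr_rle0// normr_le0 subr_eq0 => /eqP.
have Q0 : Q 0 = 0 by apply: Q_eq; rewrite ?lexx ?ler01// time_map0 clamp_id// ltW.
have QL : Q (b - a) = 1 by apply: Q_eq; rewrite ?lexx ?ler01// TL clamp_id// ltW.
pose q x := Q (b - x).
have qlip x y : `|q x - q y| <= (kmin M)^-1 * `|x - y|.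
  rewrite -ler_pdivrMl ?invr_gt0// invrK (le_trans (Qlip _ _))//.
  by rewrite (_ : b - x - (b - y) = y - x) 1?distrC//; ring.
pose u x := M * (1 - q x ^+ 2).
pose w x := Num.sqrt (energy_drop P M (q x)).
have wE x : w x = Num.sqrt (P M - P (u x)) by [].
have uM x : 0 <= u x <= M.
  have /andP[q0 q1] := Q01 (b - x); have q2 : q x ^+ 2 <= 1 by rewrite expr_le1.
  rewrite mulr_ge0 ?subr_ge0 ?(ltW M0)//= -[leRHS]mulr1 ler_pM2l//.
  by have := sqr_ge0 (q x); lra.
have udist x y : `|u x - u y| = M * (q x + q y) * `|q x - q y|.
  rewrite (_ : u x - u y = M * (q x + q y) * (q y - q x)); last by rewrite /u; ring.
  rewrite normrM distrC ger0_norm// mulr_ge0 ?(ltW M0)// addr_ge0//.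
    by case/andP: (Q01 (b - x)).
  by case/andP: (Q01 (b - y)).
have ulip x y : `|u x - u y| <= M * 2 * (kmin M)^-1 * `|x - y|.
  rewrite udist -[leRHS]mulrA ler_pM//.
    by rewrite mulr_ge0 ?(ltW M0)// addr_ge0//; [case/andP: (Q01 (b - x))|case/andP: (Q01 (b - y))].
  rewrite ler_pM2l//.
  have /andP[_ +] := Q01 (b - x); have /andP[_ +] := Q01 (b - y).
  by rewrite -/(q x) -/(q y); lra.
have wlip x y : `|w x - w y| <= 2 * B M * M / Num.sqrt (m * M) * (kmin M)^-1 * `|x - y|.
  apply: (le_trans (sqrt_energy_drop_lipschitz M0 (Q01 (b - x)) (Q01 (b - y)))).
  rewrite -[leRHS]mulrA ler_wpM2l//; last exact: qlip.
  by rewrite divr_ge0 ?sqrtr_ge0// !mulr_ge0 ?(ltW M0)// (le_trans _ (upper_slope_ge hP M0))// ltW.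
have inL : forall x, x \in `]a, b[ -> 0 < b - x < b - a.
  by move=> x; rewrite in_itv/= => /andP[ax xb]; apply/andP; split; lra.
have w_gt0 : forall x, x \in `]a, b[ -> 0 < w x.
  move=> x /inL xL; have [/andP[q0 _] _] := Qder _ xL.
  by rewrite sqrtr_gt0; apply: (energy_drop_gt0 hP).
have u_gt0 : forall x, x \in `]a, b[ -> 0 < u x.
  move=> x /inL xL; have [/andP[q0 q1] _] := Qder _ xL.
  by rewrite mulr_gt0// subr_gt0 expr_lt1// ltW.
have uder : forall x : R, x \in `]a, b[ -> is_derive x 1 u (w x).
  move=> x xab; have xL := inL _ xab; have [/andP[q0 q1] Qd] := Qder _ xL.
  have bd : is_derive x 1 (fun z : R => b - z) (-1).
    apply/is_derive1_caratheodory; exists (fun=> -1); split => //.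
    - by move=> z; ring.
    - exact: cvg_cst.
  have qd := @is_derive1_comp _ Q (fun z : R => b - z) x _ _ Qd bd.
  have Fd : is_derive ((Q \o (fun z : R => b - z)) x) 1
      (fun t : R => M * (1 - t ^+ 2)) (- (2 * M * q x)).
    apply/is_derive1_caratheodory; exists (fun z => - M * (z + q x)); split.
    - by move=> z; rewrite /q /=; ring.
    - by apply: cvgM; [exact: cvg_cst|apply: cvgD; [exact: cvg_id|exact: cvg_cst]].
    - by rewrite /q /=; ring.
  have := is_derive1_comp Fd qd.
  rewrite (_ : _ * _ = w x)//.
  rewrite /slowness -/(q x) -/(w x) /GRing.scale/=.
  by field; rewrite !gt_eqF// w_gt0.
have cu := lipschitz_continuous ulip; have cw := lipschitz_continuous wlip.
have N0 : mu (`]a, b[ `&` u @^-1` E) = 0%E.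
  (* u is not expanding near its maximum b, but it is on each interval D n;
     these exhaust ]a, b[. *)
  pose D n : set R := `]a, b - (b - a) / n.+2%:R]%classic.
  have D0 n : mu (D n `&` u @^-1` E) = 0%E.
    have n2 : 0 < (b - a) / n.+2%:R by rewrite divr_gt0.
    have n21 : (b - a) / n.+2%:R < b - a by rewrite ltr_pdivrMr// ltr_pMr// ltr1n.
    move: n2 n21; rewrite /D; move: ((b - a) / n.+2%:R) => l n2 n21.
    pose eta := Q l.
    have eta0 : 0 < eta by by have [|/andP[]//] := Qder l; rewrite n2.
    have qge x : `]a, b - l]%classic x -> eta <= q x.
      rewrite /= in_itv/= => /andP[ax xb]; rewrite leNgt; apply/negP => qx.
      have /andP[q0 _] := Q01 (b - x); have /andP[_ e1] := Q01 l.
      have := time_map_ge hP M0 q0 (ltW qx) e1; rewrite !TQ !clamp_id; [|lra..].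
      have := mulr_gt0 kmin0 (_ : 0 < eta - q x); rewrite subr_gt0 => /(_ qx).
      by rewrite /kmin -/(q x) -/eta; lra.
    apply: (@expanding_preimage_null _ _ _ u (2 * M * eta / kmax M)) => //.
      by rewrite divr_gt0// !mulr_gt0.
    move=> x y Dx Dy; rewrite udist mulrAC ler_pdivrMr//.
    have qx := qge _ Dx; have qy := qge _ Dy.
    move: Dx Dy; rewrite /= !in_itv/= => /andP[ax xb] /andP[ay yb].
    have := Qexp (b - x) (b - y).
    rewrite (_ : b - x - (b - y) = y - x); last by ring.
    rewrite [`|y - x|]distrC => H.
    have {}H : `|x - y| <= kmax M * `|q x - q y| by apply: H; apply/andP; split; lra.
    have nxy := normr_ge0 (x - y).
    apply: (@le_trans _ _ (M * (q x + q y) * `|x - y|)).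
      rewrite ler_wpM2r// [2 * M]mulrC -mulrA ler_pM2l//; lra.
    rewrite -[leRHS]mulrA [X in _ <= _ * X]mulrC ler_wpM2l// mulr_ge0 ?(ltW M0)//; lra.
  apply/eqP; rewrite -measure_le0.
  apply: (@le_trans _ _ (mu (\bigcup_n (D n `&` u @^-1` E)))).
    apply: le_outer_measure => x [xab Ex].
    move: xab; rewrite /= in_itv/= => /andP[ax xb].
    exists (Num.bound ((b - a) / (b - x))) => //; split=> //.
    rewrite /D /= in_itv/= ax/= lerBrDr -lerBrDl ler_pdivrMr// mulrC -ler_pdivrMr ?subr_gt0//.
    apply: (@le_trans _ _ (Num.bound ((b - a) / (b - x)))%:R); last first.
      by rewrite ler_nat (leq_trans (leqnSn _) (leqnSn _)).
    by apply/ltW/archi_boundP; rewrite divr_ge0// subr_ge0 ltW.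
  apply: (le_trans (outer_measure_sigma_subadditive _ _)).
  by rewrite eseries0// => n _ _; exact: D0.
exists u, w; split => //.
- split => //.
  + by rewrite /u /q QL expr1n subrr mulr0.
  + by rewrite /u /q subrr Q0 expr0n/= subr0 mulr1.
move=> x; rewrite in_itv/= => /andP[ax xb].
have wb : w b = 0 by rewrite /w /q subrr Q0 /energy_drop expr0n/= subr0 mulr1 subrr sqrtr0.
have wN y z : `|- w y - - w z| <= 2 * B M * M / Num.sqrt (m * M) * (kmin M)^-1 * `|y - z|.
  by rewrite -opprD normrN; exact: wlip.
have mh : measurable_fun (`[x, b] : set R) (fun t => rho (u t)).
  apply: (@measurable_funS _ _ _ _ setT) => //; apply: measurableT_comp => //.
  exact: continuous_measurable_fun.
have neg : mu.-negligible (`]a, b[ `&` u @^-1` E).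
  apply/negligibleP => //.
  apply: measurableI => //; rewrite -[X in measurable X]setTI.
  by apply: continuous_measurable_fun.
have der y : y \in `]x, b[ -> ~ (`]a, b[ `&` u @^-1` E) y ->
    is_derive y 1 (fun y => - w y) (rho (u y)).
  rewrite in_itv/= => /andP[xy yb] nE.
  have yab : y \in `]a, b[ by rewrite in_itv/= yb andbT; exact: le_lt_trans xy.
  have uE : ~ E (u y) by move=> Ey; apply: nE; split.
  have wy := w_gt0 _ yab.
  have Du : 0 < P M - P (u y) by rewrite -sqrtr_gt0 -wE.
  have Pu := @is_derive1_comp _ P u y _ _ (dP _ (u_gt0 _ yab) uE) (uder _ yab).
  have PMu : is_derive y 1 (fun z => P M - P (u z)) (- (2 * rho (u y) * w y)).
    rewrite -[X in is_derive _ _ _ X]sub0r.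
    exact: (is_deriveB (is_derive_cst (P M) y 1) Pu).
  have sD := @is_derive1_comp _ (@Num.sqrt R) (fun z => P M - P (u z)) y _ _
    (is_derive1_sqrt Du) PMu.
  apply: (is_derive_eq (is_deriveN sD)).
  by rewrite -wE; field; rewrite gt_eqF.
rewrite (lipschitz_FTC2 xb wN mh neg der).
by rewrite wb oppr0 sub0r opprK.
Qed.

End solution.

(** * The potential of the nonlinearity *)

Section primitive_potential.
Context {R : realType}.
Variables (h : R -> R) (m0 : R) (beta : R -> R).
Hypothesis m0_gt0 : 0 < m0.
Hypothesis mh : measurable_fun [set: R] h.
Hypothesis h_ge : forall t, m0 <= h t.
Hypothesis h_le : forall K t, `|t| <= K -> h t <= beta K.
Implicit Types (x y t K : R).

Lemma density_integrable x y : mu.-integrable `[x, y] (EFin \o h).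
Proof.
apply: (@bounded_integrable _ _ _ _ (beta (`|x| + `|y|))).
  exact: measurable_funTS.
move=> t; rewrite in_itv/= => /andP[xt ty].
rewrite ger0_norm ?(le_trans _ (h_ge t)) ?(ltW m0_gt0)//; apply: h_le.
rewrite ler_norml; apply/andP; split.
  by have := ler_norm (- x); rewrite normrN; have := normr_ge0 y; lra.
by have := ler_norm y; have := normr_ge0 x; lra.
Qed.

(** For negative [t] the segment from [0] to [t] is empty, so this vanishes there, as
    [potential] requires. *)
Definition antideriv t := \int[mu]_(r in `[0, t]) h r.

Lemma antideriv_le0 t : t <= 0 -> antideriv t = 0.
Proof.
rewrite /antideriv le_eqVlt => /predU1P[->|t0]; first by rewrite set_itv1 Rintegral_set1.
by rewrite set_itv_ge ?Rintegral_set0// bnd_simp -ltNge.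
Qed.

Lemma antiderivB x y : 0 <= x -> x <= y -> antideriv y - antideriv x = \int[mu]_(r in `[x, y]) h r.
Proof.
move=> x0 xy; rewrite /antideriv (@Rintegral_chasles _ _ 0 x y)//; last exact: density_integrable.
by rewrite addrC addKr.
Qed.

Lemma antideriv_ge x y : 0 <= x -> x <= y -> m0 * (y - x) <= antideriv y - antideriv x.
Proof.
move=> x0 xy; rewrite antiderivB//; apply: Rintegral_ge_bound => //; exact: density_integrable.
Qed.

Lemma antideriv_le K x y : 0 <= x -> x <= y -> y <= K ->
  antideriv y - antideriv x <= beta K * (y - x).
Proof.
move=> x0 xy yK; rewrite antiderivB//; apply: Rintegral_le_bound => //.
  exact: density_integrable.
move=> t; rewrite in_itv/= => /andP[xt ty]; apply: h_le; rewrite ger0_norm; lra.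
Qed.

Lemma beta_ge K : 0 <= K -> m0 <= beta K.
Proof. by move=> K0; rewrite (le_trans (h_ge K))// h_le// ger0_norm. Qed.

Lemma antideriv_continuous : continuous antideriv.
Proof.
have lip K x y : 0 <= K -> x <= y -> y <= K -> `|antideriv x - antideriv y| <= beta K * `|x - y|.
  move=> K0 xy yK; have b0 : 0 <= beta K by rewrite (le_trans _ (beta_ge K0))// ltW.
  rewrite distrC [`|x - y|]distrC [`|y - x|]ger0_norm ?subr_ge0//.
  have [y0|y0] := leP y 0.
    by rewrite !antideriv_le0 ?(le_trans xy)// subrr normr0 mulr_ge0// subr_ge0.
  have [x0|x0] := leP x 0.
    have h1 := antideriv_ge (lexx 0) (ltW y0); have h2 := antideriv_le (lexx 0) (ltW y0) yK.
    have h3 : beta K * (y - 0) <= beta K * (y - x) by rewrite ler_wpM2l//; lra.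
    rewrite (antideriv_le0 x0) -(antideriv_le0 (lexx 0)) ger0_norm; first lra.
    by apply: le_trans h1; rewrite mulr_ge0 ?(ltW m0_gt0)//; lra.
  have h1 := antideriv_ge (ltW x0) xy; have h2 := antideriv_le (ltW x0) xy yK.
  rewrite ger0_norm//; apply: le_trans h1.
  by rewrite mulr_ge0 ?(ltW m0_gt0)//; lra.
move=> x; apply/cvgrPdist_le => e e0.
pose K := `|x| + 1; have K0 : 0 <= K by rewrite addr_ge0.
have b0 : 0 < beta K by apply: lt_le_trans (beta_ge K0).
near=> y.
have xy1 : `|x - y| <= 1.
  by near: y; apply: cvgr_dist_le; [exact: cvg_id|exact: ltr01].
have yK : y <= K.
  have := ler_norm (y - x); rewrite distrC /K; have := ler_norm x; lra.
have xK : x <= K by rewrite /K; have := ler_norm x; lra.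
have xy : `|x - y| <= e / beta K.
  by near: y; apply: cvgr_dist_le; [exact: cvg_id|exact: divr_gt0].
rewrite ler_pdivlMr// mulrC in xy; apply: le_trans xy.
have [xy|/ltW yx] := leP x y; first exact: lip.
by rewrite distrC [`|x - y|]distrC; exact: lip.
Unshelve. all: by end_near. Qed.

Lemma antideriv_derive : exists2 E : set R, measurable E /\ mu E = 0%E &
  forall y, 0 < y -> ~ E y -> is_derive y 1 antideriv (h y).
Proof.
have li : locally_integrable [set: R] h.
  split => //; first exact: openT.
  move=> K _ cK; have [M [Mr KM]] := compact_bounded cK.
  have KM1 : K `<=` `[- (M + 1), M + 1]%classic.
    by move=> x Kx; rewrite /= in_itv/= -ler_norml; apply: (KM (M + 1)) => //; rewrite ltrDl.
  have iK : mu.-integrable K (EFin \o h).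
    by apply: integrableS (density_integrable (- (M + 1)) (M + 1)) => //; exact: compact_measurable.
  by have /integrableP[] := iK.
have := @FTC1 R h (BLeft 0) (fun y => density_integrable 0 y) li.
move=> [E [mE E0 NE]]; exists E => // y y0 nE.
have [] : derivable antideriv y 1 /\ derive1 antideriv y = h y.
  apply: contrapT => nd; apply: nE; apply: NE => /= H; apply: nd; apply: H.
  by rewrite lte_fin.
by move=> d1 d2; apply: DeriveDef; [exact: d1|rewrite -derive1E; exact: d2].
Qed.

Lemma antideriv_potential (l : R) : 0 < l ->
  potential (fun t => 2 * l * antideriv t) (fun K => 2 * l * beta K) (2 * l * m0).
Proof.
move=> l0; have l20 : 0 < 2 * l by rewrite mulr_gt0.
split.
- by rewrite mulr_gt0.
- by move=> t; apply: cvgM; [exact: cvg_cst|exact: (@antideriv_continuous t)].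
- by move=> t t0; rewrite antideriv_le0// mulr0.
- by move=> x y x0 xy; rewrite -mulrBr -[leLHS]mulrA ler_pM2l//; exact: antideriv_ge.
- by move=> K x y x0 xy yK; rewrite -mulrBr -[leRHS]mulrA ler_pM2l//; exact: antideriv_le.
Qed.

End primitive_potential.

(** For [M >= (2 |C| D) ^ (1 / (1 - r))] one has [M ^ (1 - r) >= 2 |C| D], that is,
    [M / 2 >= |C| D M ^ r]. *)
Lemma sublinear_growth {R : realType} (A D r d C : R) : 0 <= A -> 0 <= D -> r < 1 -> 0 < d ->
  exists2 M, d <= M & C * (A + D * M `^ r) <= M.
Proof.
move=> A0 D0 r1 d0; pose X := (2 * `|C| * D) `^ (1 - r)^-1.
pose M := Num.max d (Num.max (2 * `|C| * A) X).
have dM : d <= M by rewrite le_max lexx.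
have CM : 2 * `|C| * A <= M by rewrite !le_max lexx orbT.
have XM : X <= M by rewrite !le_max lexx !orbT.
have M0 : 0 < M by exact: lt_le_trans dM.
exists M => //.
have CD0 : 0 <= 2 * `|C| * D by rewrite !mulr_ge0.
have H : 2 * `|C| * D <= M `^ (1 - r).
  have -> : 2 * `|C| * D = X `^ (1 - r).
    by rewrite -powRrM mulVf ?powRr1// gt_eqF// subr_gt0.
  by apply: ge0_ler_powR => //; rewrite ?nnegrE ?powR_ge0 ?subr_ge0 ?ltW.
have MM : M `^ (1 - r) * M `^ r = M.
  rewrite -powRD ?subrK ?powRr1 ?(ltW M0)//.
  by apply/implyP => _; rewrite gt_eqF.
have H2 : 2 * `|C| * D * M `^ r <= M by rewrite -[leRHS]MM ler_wpM2r// powR_ge0.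
apply: (@le_trans _ _ (`|C| * (A + D * M `^ r))).
  by rewrite ler_wpM2r ?ler_norm// addr_ge0// mulr_ge0// powR_ge0.
rewrite mulrDr mulrA; lra.
Qed.

(** * The multiplicity theorem *)

Lemma J_antideriv {R : realType} (g h : R -> R) (E : set R) (m0 : R) (beta : R -> R) t :
  0 < m0 -> measurable E -> mu E = 0%E -> measurable_fun [set: R] h ->
  (forall x, ~ E x -> h x = g x) -> (forall x, m0 <= h x) ->
  (forall K x, `|x| <= K -> h x <= beta K) -> 0 <= t -> J g t = antideriv h t.
Proof.
move=> m0_gt0 mE E0 mh hg hm hb t0; rewrite /J t0 /antideriv.
have mt : measurable (`[0, t]%classic : set (cara R)) by exact: measurable_cara.
have hgE : {ae leb R, forall x, `[0, t]%classic x -> h x = g x}.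
  apply/leb_negligible; exists E; split => // x /= /not_implyP[_ hgx].
  by apply: contrapT => nE; apply: hgx; rewrite hg.
have mht : measurable_fun (`[0, t] : set R) h by exact: measurable_funTS.
have mhc : measurable_fun (`[0, t] : set (cara R)) (EFin \o h).
  by apply/measurable_EFinP; exact: measurable_fun_cara.
by rewrite -(ae_eq_Rintegral_leb mt hgE mhc) Rintegral_leb.
Qed.

Theorem theorem5p1 (R : realType) (a b : R) (g : R -> R) (alpha s c d : R)
  (hab : a < b)
  (hg : ae_continuous g)
  (halpha : 0 < alpha)
  (hs : s \in `]1, 2[)
  (hc : 0 < c) (hcd : c < d)
  (hi : forall t : R, g t <= alpha * (1 + `|t| `^ (s - 1)))
  (hii : (0 < ess_inf (leb R) (EFin \o g))%E)
  (hiii : J g c / c ^+ 2 < J g d / (4 * d ^+ 2)) :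
  forall lambda : R,
    lambda \in `] 2 * d ^+ 2 / ((b - a) ^+ 2 * J g d),
                  c ^+ 2 / (2 * (b - a) ^+ 2 * J g c) [ ->
    exists u : 'I_3 -> R -> R,
      (forall i, weak_solution a b g lambda (u i) /\
                 differ_on a b (u i) (fun=> 0)) /\
      (forall i j, i != j -> differ_on a b (u i) (u j)).
Proof.
move=> lambda; rewrite in_itv/= => /andP[l1 l2].
have ba : 0 < b - a by rewrite subr_gt0.
have hd : 0 < d by exact: lt_trans hcd.
move: hs; rewrite in_itv/= => /andP[s1 s2].
have [m0 m0_gt0 hm] : exists2 m0 : R, 0 < m0 & \forall t \ae leb R, m0 <= g t.
  have [r r0 rg] : exists2 r : R, 0 < r & (r%:E <= ess_inf (leb R) (EFin \o g))%E.
    move: hii; case: (ess_inf _ _) => [r|_|//]; first by exists r.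
    by exists 1 => //; exact: leey.
  by exists r => //; move/ess_infP : rg.
have [E0 [h [[mE0 E00] mh hg' hm0 hor]]] := ae_continuous_borel hg hm.
(* m0 accounts for the values of h on the exceptional null set. *)
pose beta (K : R) := m0 + alpha + alpha * K `^ (s - 1).
have h_le K t : `|t| <= K -> h t <= beta K.
  move=> tK; have p0 : 0 <= alpha * K `^ (s - 1) by rewrite mulr_ge0 ?powR_ge0// ltW.
  have [->|->] := hor t; rewrite /beta; last lra.
  have := hi t; have : alpha * `|t| `^ (s - 1) <= alpha * K `^ (s - 1).
    rewrite ler_pM2l// ge0_ler_powR ?nnegrE//; first lra.
    exact: le_trans tK.
  lra.
have Jc : J g c = antideriv h c by apply: (J_antideriv m0_gt0 mE0 E00 mh hg' hm0 h_le); exact: ltW.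
have Jd : J g d = antideriv h d by apply: (J_antideriv m0_gt0 mE0 E00 mh hg' hm0 h_le); exact: ltW.
have antideriv_gt0 t : 0 < t -> 0 < antideriv h t.
  move=> t0; have := antideriv_ge m0_gt0 mh hm0 h_le (lexx 0) (ltW t0).
  rewrite (@antideriv_le0 _ h 0 (lexx 0)) !subr0; apply: lt_le_trans; exact: mulr_gt0.
have pc := antideriv_gt0 _ hc; have pd := antideriv_gt0 _ hd.
rewrite Jd ltr_pdivrMr in l1; last by rewrite mulr_gt0// exprn_gt0.
rewrite Jc ltr_pdivlMr in l2; last by rewrite !mulr_gt0// exprn_gt0.
have l0 : 0 < lambda.
  rewrite -(pmulr_lgt0 _ (_ : 0 < (b - a) ^+ 2 * antideriv h d)); last first.
    by rewrite mulr_gt0// exprn_gt0.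
  by apply: lt_trans l1; rewrite mulr_gt0// exprn_gt0.
have hP := antideriv_potential m0_gt0 mh hm0 h_le l0.
have [E1 [mE1 E10] dprim] := antideriv_derive m0_gt0 mh hm0 h_le.
have [||C|M [M0 TM Mneq]] := three_amplitudes hP ba hc hcd.
- rewrite expr_div_n ltr_pdivlMr ?exprn_gt0//; lra.
- rewrite expr_div_n mulrA ltr_pdivrMr ?exprn_gt0//; lra.
- have [||||K dK KC] := @sublinear_growth R (m0 + alpha) alpha (s - 1) d (C * (2 * lambda)).
  + by rewrite addr_ge0// ltW.
  + exact: ltW.
  + lra.
  + by [].
  + by exists K => //; rewrite mulrA.
have mE : measurable (E0 `|` E1) by exact: measurableU.
have EE : mu (E0 `|` E1) = 0%E by rewrite measureU0.
have sol i : exists uw : (R -> R) * (R -> R),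
    weak_solution a b g lambda uw.1 /\ uw.1 b = M i.
  have [|y y0 nE|u [w [[cu cw ua ub uM] du uE wE]]] :=
    solution_of_amplitude hP hab (M0 i) (TM i) mE EE (rho := fun t => lambda * h t).
  - by apply: measurable_funM => //; exact: measurable_cst.
  - have Dy : is_derive y 1 (antideriv h) (h y) by apply: dprim => // E1y; apply: nE; right.
    by rewrite mulrA; exact: is_deriveZ.
  exists (u, w); split => //=.
  apply: (weak_solutionP (h := h) (C := beta (M i)) hab cu cw ua du mh _ _ wE).
  - move=> x; have /andP[u0 uMi] := uM x.
    rewrite ger0_norm ?(le_trans _ (hm0 _)) ?(ltW m0_gt0)//.
    by apply: h_le; rewrite ger0_norm.
  - have : mu.-negligible (`]a, b[ `&` u @^-1` (E0 `|` E1)).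
      apply/negligibleP => //; apply: measurableI => //.
      rewrite -[X in measurable X]setTI.
      by apply: continuous_measurable_fun.
    apply: negligibleS => x [xab /= gh]; split => //.
    by left; apply: contrapT => nE; apply: gh; rewrite hg'.
have [uw uwP] := choice sol.
exists (fun i => (uw i).1); split.
  move=> i; have [ws ub] := uwP i; split => //.
  by exists b; rewrite ?in_itv/= ?lexx ?(ltW hab)// ub gt_eqF.
move=> i j ij; have [_ ubi] := uwP i; have [_ ubj] := uwP j.
by exists b; rewrite ?in_itv/= ?lexx ?(ltW hab)// ubi ubj Mneq.
Qed.
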